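(* Let $1\le d\le D$, let $U:\mathbb R^d\to[-\infty,\infty)$ be a (Borel measurable) utility function supported on $\mathbb R_+^d$, let $\tilde U$ be its extension to $\mathbb R^D$, and let $u(x)=\sup\{\mathrm E[\tilde U(X)]:X\in\mathcal A_T^x\}$, $x\in\mathbb R^D$, be the value function, with $C_u:=\operatorname{cl}(\operatorname{dom}(u))$. Suppose that $u(x_0)<\infty$ for some $x_0\in\operatorname{int}(\operatorname{dom}(u))$. 1. For any $x\in\mathbb R^D$, $$\sup_{X\in\mathcal C}\mathbb U_x(X)\le u(x)\le\inf_{m\in\mathcal D}\mathbb U_x^*(m).$$ 2. If $x\in\operatorname{int}(\operatorname{dom}(u))=\operatorname{int}(C_u)$ then $$\sup_{X\in\mathcal C}\mathbb U_x(X)=u(x)=\min_{m\in\mathcal D}\mathbb U_x^*(m)\in\mathbb R$$ (in particular the minimum is attained). 3. If $x\notin\operatorname{cl}(\operatorname{dom}(u))=C_u$ then $$\sup_{X\in\mathcal C}\mathbb U_x(X)=u(x)=\inf_{m\in\mathcal D}\mathbb U_x^*(m)=-\infty.$$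
   Context: Utility functions. For concave $f:\mathbb R^n\to[-\infty,\infty]$: $\operatorname{dom}(f)=\{f>-\infty\}$; $f$ is proper concave if $\operatorname{dom}(f)\neq\emptyset$ and $f<\infty$ everywhere. For a convex cone $C$ ($\lambda C+\mu C\subseteq C$ for $\lambda,\mu\ge0$), $x'\succeq_C x$ means $x'-x\in C$. A proper concave $f:\mathbb R^n\to[-\infty,\infty)$ is a utility function if $C_f:=\operatorname{cl}(\operatorname{dom}(f))$ is a convex cone with $\mathbb R_+^n\subseteq C_f\ne\mathbb R^n$ and $f$ is increasing with respect to $\succeq_{C_f}$; $f$ is then said to be supported on $C_f$. The extension is $\tilde U(x)=U(x_1,\dots,x_d)$ for $x\in\mathbb R_+^D$ and $\tilde U(x)=-\infty$ otherwise. Market. A $D\times D$ matrix $\Pi=(\pi^{ij})$ is a bid-ask matrix if $\pi^{ij}>0$, $\pi^{ii}=1$ and $\pi^{ij}\le\pi^{ik}\pi^{kj}$ for all $i,j,k$. Its solvency cone $K(\Pi)\subseteq\mathbb R^D$ is the convex cone generated by the canonical basis vectors $e^i$ and the vectors $\pi^{ij}e^i-e^j$; $K^*(\Pi)=\{w\in\mathbb R^D:\langle v,w\rangle\ge0\ \forall v\in K(\Pi)\}$. Let $(\Omega,(\mathcal F_t)_{t\in[0,T]},\mathbb P)$ be a filtered probability space satisfying the usual conditions, and $(\Pi_t)_{t\in[0,T]}$ a fixed adapted càdlàg process with values in the bid-ask matrices; write $K_\tau=K(\Pi_\tau)$, $K_{\tau-}=K(\Pi_{\tau-})$, and similarly $K_\tau^*,K_{\tau-}^*$.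 Standing assumptions: $\mathcal F_{T-}=\mathcal F_T$ and $\Pi_{T-}=\Pi_T$ a.s., and $\mathcal Z^s\ne\emptyset$ ($\mathcal Z^s$ defined next). A consistent price process is an adapted $\mathbb R_+^D\setminus\{0\}$-valued càdlàg martingale $Z$ with $Z_t\in K_t^*$ a.s. for all $t\in[0,T]$; it is strictly consistent if moreover $Z_\tau\in\operatorname{int}(K_\tau^* )$ a.s. on $\{\tau<\infty\}$ for every $[0,T]\cup\{\infty\}$-valued stopping time $\tau$ and $Z_{\sigma-}\in\operatorname{int}(K_{\sigma-}^* )$ a.s. on $\{\sigma<\infty\}$ for every predictable $[0,T]\cup\{\infty\}$-valued stopping time $\sigma$. $\mathcal Z^s$ is the set of strictly consistent price processes. A self-financing portfolio process is an $\mathbb R^D$-valued predictable process $V=(V_t)_{t\in[0,T]}$ with a.e. path of finite variation (not necessarily right-continuous) such that for all stopping times $0\le\sigma\le\tau\le T$, $V_\tau-V_\sigma\in-\overline{\operatorname{conv}}(\bigcup_{\sigma\le t<\tau}K_t,0)$ a.s. (pathwise closed convex hull of the union together with $0$). It is admissible if there is $a>0$ such that $V_T+a\mathbf 1\in K_T$ a.s. and $\langle V_\tau+a\mathbf 1,Z_\tau^s\rangle\ge0$ a.s. for all $[0,T]$-valued stopping times $\tau$ and all $Z^s\in\mathcal Z^s$, where $\mathbf 1=(1,\dots,1)$. $\mathcal A^x$ is the set of admissible self-financing portfolio processes with $V_0=x$, and $\mathcal A_T^x=\{V_T:V\in\mathcal A^x\}$. Convention: $\mathrm E[\tilde U(X)]=-\infty$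 whenever $\mathrm E[\tilde U(X)^-]=\infty$. Dual problem. $L^\infty(\mathbb R^D)$ is the space of essentially bounded $\mathcal F_T$-measurable $\mathbb R^D$-valued random variables. $\operatorname{ba}(\mathbb R^D)$ is the space of bounded finitely additive $m=(m_1,\dots,m_D):\mathcal F_T\to\mathbb R^D$ with $m(A)=0$ whenever $\mathbb P(A)=0$, identified with the dual of $L^\infty(\mathbb R^D)$ through $m(X)=\sum_{i=1}^D\int_\Omega X_i\,dm_i$. Put $\mathcal C=\mathcal A_T^0\cap L^\infty(\mathbb R^D)$, $\mathcal D=\{m\in\operatorname{ba}(\mathbb R^D): m(X)\le0\ \forall X\in\mathcal C\}$, $\mathbb U_x(X)=\mathrm E[\tilde U(x+X)]$ for $X\in L^\infty(\mathbb R^D)$, and $\mathbb U_x^*(m)=\sup_{X\in L^\infty(\mathbb R^D)}\{\mathbb U_x(X)-m(X)\}$ for $m\in\operatorname{ba}(\mathbb R^D)$. *)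

(* Defs.v *)
From HB Require Import structures.
From mathcomp Require Import all_boot all_order all_algebra.
From mathcomp Require Import all_classical all_reals all_analysis.

Set Implicit Arguments.
Unset Strict Implicit.
Unset Printing Implicit Defensive.

Import Order.TTheory GRing.Theory Num.Theory.
Import numFieldNormedType.Exports.

Local Open Scope classical_set_scope.
Local Open Scope ring_scope.

(* R^n is the type 'rV[R]_n of row vectors, with the library's (sup-norm)
   topology. *)

Section Vectors.
Context {R : realType}.

Definition dot n (v w : 'rV[R]_n) : R := \sum_i v 0 i * w 0 i.

Definition orthant n : set 'rV[R]_n := [set x | forall i, 0 <= x 0 i].

Definition convex_cone n (C : set 'rV[R]_n) : Prop :=
  forall (l m : R) (x y : 'rV[R]_n),
    0 <= l -> 0 <= m -> C x -> C y -> C (l *: x + m *: y).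

Definition cone_hull n (G : set 'rV[R]_n) : set 'rV[R]_n :=
  smallest (@convex_cone n) G.

Definition closed_convex_hull n (G : set 'rV[R]_n) : set 'rV[R]_n :=
  closure (smallest (fun A : set 'rV[R]_n => convex_set A) G).

Definition dual_cone n (C : set 'rV[R]_n) : set 'rV[R]_n :=
  [set w | forall v, C v -> 0 <= dot v w].

Definition borel {E : topologicalType} : set_system E :=
  <<s [set A : set E | open A] >>.

(* measurability of a map with respect to a sigma-algebra that need not be the
   canonical one of its domain *)
Definition measurable_for {A : Type} {E : topologicalType}
    (G : set_system A) (X : A -> E) : Prop :=
  forall B, borel B -> G (X @^-1` B).

End Vectors.

Section Utility.
Context {R : realType}.
Local Open Scope ereal_scope.

Definition dom n (f : 'rV[R]_n -> \bar R) : set 'rV[R]_n :=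
  [set x | -oo < f x].

(* As -oo + +oo = -oo in \bar R, the inequality says that the hypograph of f
   is convex, also when f takes infinite values. *)
Definition concave n (f : 'rV[R]_n -> \bar R) : Prop :=
  forall (x y : 'rV[R]_n) (t : R), (0 < t)%R -> (t < 1)%R ->
    t%:E * f x + (1 - t)%:E * f y <= f (t *: x + (1 - t) *: y)%R.

Definition proper_concave n (f : 'rV[R]_n -> \bar R) : Prop :=
  [/\ concave f, dom f !=set0 & forall x, f x < +oo].

Definition utility_function n (f : 'rV[R]_n -> \bar R) : Prop :=
  let C := closure (dom f) in
  [/\ proper_concave f, convex_cone C, @orthant R n `<=` C, C <> setT
    & forall x x' : 'rV[R]_n, C (x' - x)%R -> f x <= f x'].

Definition supported_on n (f : 'rV[R]_n -> \bar R) (C : set 'rV[R]_n) : Prop :=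
  utility_function f /\ closure (dom f) = C.

Definition extension d D (leD : (d <= D)%N) (U : 'rV[R]_d -> \bar R)
    (x : 'rV[R]_D) : \bar R :=
  if `[< orthant x >] then U (\row_i x 0 (widen_ord leD i))%R else -oo.

End Utility.

Section BidAsk.
Context {R : realType} {D : nat}.

Definition bid_ask_matrix (Pi : 'M[R]_D) : Prop :=
  [/\ forall i j, 0 < Pi i j, forall i, Pi i i = 1
    & forall i j k, Pi i j <= Pi i k * Pi k j].

Definition basis_vec (i : 'I_D) : 'rV[R]_D := delta_mx 0 i.

Definition solvency_cone (Pi : 'M[R]_D) : set 'rV[R]_D :=
  cone_hull (range basis_vec `|`
    range (fun ij : 'I_D * 'I_D =>
      Pi ij.1 ij.2 *: basis_vec ij.1 - basis_vec ij.2)).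

Definition solvency_dual (Pi : 'M[R]_D) : set 'rV[R]_D :=
  dual_cone (solvency_cone Pi).

End BidAsk.

Section Processes.
Context {R : realType} {dsp : measure_display} {Omega : measurableType dsp}.
Variables (P : probability Omega R) (T : R) (F : R -> set_system Omega).

(* Time is R, but only the times in [0, T] matter. *)

Definition cadlag {E : topologicalType} (x : R -> E) : Prop :=
  (forall t : R, 0 <= t -> t < T -> x @ t^'+ --> x t) /\
  (forall t : R, 0 < t -> t <= T -> exists l : E, x @ t^'- --> l).

(* The left limit at time 0 is the value at time 0. *)
Definition left_lim {E : ptopologicalType} (x : R -> E) (t : R) : E :=
  if t <= 0 then x t else lim (x @ t^'-).

Definition usual_filtration : Prop :=
  [/\ forall t, 0 <= t -> t <= T ->
        sigma_algebra setT (F t) /\ F t `<=` measurable,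
      forall s t, 0 <= s -> s <= t -> t <= T -> F s `<=` F t,
      forall N, P.-negligible N -> F 0 N
    & forall t, 0 <= t -> t < T ->
        F t = \bigcap_(s in [set s | t < s /\ s <= T]) F s].

Definition left_sigma_algebra (t : R) : set_system Omega :=
  <<s \bigcup_(s in [set s | 0 <= s /\ s < t]) F s >>.

Definition adapted {E : topologicalType} (X : R -> Omega -> E) : Prop :=
  forall t, 0 <= t -> t <= T -> measurable_for (F t) (X t).

(* the sigma-algebra on [0, T] x Omega generated by the sets {0} x A, with A in
   F_0, and ]s, t] x A, with A in F_s *)
Definition predictable_sets : set_system (R * Omega) :=
  <<s `[0, T] `*` setT,
      [set [set 0] `*` A | A in F 0] `|`
      [set B | exists s t A, [/\ 0 <= s, s < t, t <= T, F s A
                               & B = `]s, t] `*` A]] >>.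

Definition predictable_process {E : topologicalType} (V : R -> Omega -> E) :
    Prop :=
  forall B, borel B -> predictable_sets
    (`[0, T] `*` setT `&` (fun z : R * Omega => V z.1 z.2) @^-1` B).

(* stopping times with values in [0, T] or equal to +oo *)
Definition stopping_time (tau : Omega -> \bar R) : Prop :=
  (forall w, tau w = +oo%E \/ (0%E <= tau w)%E /\ (tau w <= T%:E)%E) /\
  (forall t, 0 <= t -> t <= T -> F t [set w | (tau w <= t%:E)%E]).

Definition finite_stopping_time (tau : Omega -> \bar R) : Prop :=
  stopping_time tau /\ forall w, (tau w < +oo)%E.

(* the stochastic interval [[tau, T]] is a predictable set *)
Definition predictable_time (tau : Omega -> \bar R) : Prop :=
  stopping_time tau /\
  predictable_sets
    [set z : R * Omega | 0 <= z.1 /\ z.1 <= T /\ (tau z.2 <= z.1%:E)%E].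

(* the value X_tau, meaningful on {tau < +oo} *)
Definition at_time {E : Type} (X : R -> Omega -> E) (tau : Omega -> \bar R)
    (w : Omega) : E :=
  X (fine (tau w)) w.

Definition before {E : ptopologicalType} (X : R -> Omega -> E) :
    R -> Omega -> E :=
  fun t w => left_lim (X^~ w) t.

Definition martingale n (Z : R -> Omega -> 'rV[R]_n) : Prop :=
  [/\ adapted Z,
      forall t i, 0 <= t -> t <= T ->
        P.-integrable setT (fun w => (Z t w 0 i)%:E)
    & forall s t i A, 0 <= s -> s <= t -> t <= T -> F s A ->
        (\int[P]_(w in A) (Z t w 0 i)%:E = \int[P]_(w in A) (Z s w 0 i)%:E)%E].

Definition Linfty (n : nat) : set (Omega -> 'rV[R]_n) :=
  [set X | measurable_for (F T) X /\
           exists M : R, \forall w \ae P, `|X w| <= M].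

(* bounded finitely additive vector measures on F_T that vanish on the null
   sets; m is only relevant on F_T *)
Definition ba n : set (set Omega -> 'rV[R]_n) :=
  [set m | [/\ forall A B, F T A -> F T B -> A `&` B = set0 ->
                 m (A `|` B) = m A + m B,
               exists M : R, forall A, F T A -> `|m A| <= M
             & forall A, F T A -> P A = 0%E -> m A = 0]].

(* The integral of f against a bounded finitely additive mu vanishing on null
   sets: the limit of the integrals of the simple functions equal to j / n on
   { j / n <= f < (j + 1) / n }, -n^2 <= j < n^2. For f essentially bounded
   they converge to f uniformly outside a null set. *)
Definition fa_sum (mu : set Omega -> R) (f : Omega -> R) (n : nat) : R :=
  let level (k : nat) : R := (k%:R - (n * n)%:R) / n%:R in
  \sum_(0 <= k < n * n + n * n)
    level k * mu [set w | level k <= f w /\ f w < level k.+1].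

Definition fa_integral (mu : set Omega -> R) (f : Omega -> R) : R :=
  lim (fa_sum mu f n @[n --> \oo]).

Definition ba_pairing n (m : set Omega -> 'rV[R]_n) (X : Omega -> 'rV[R]_n) :
    R :=
  \sum_i fa_integral (fun A => m A 0 i) (fun w => X w 0 i).

(* expectation of an extended real random variable, equal to -oo as soon as the
   negative part has infinite expectation *)
Definition expect (f : Omega -> \bar R) : \bar R :=
  if (\int[P]_w (f^\- w) == +oo)%E then -oo%E else (\int[P]_w f w)%E.

End Processes.

Arguments Linfty {R dsp Omega} P T F n _.
Arguments ba {R dsp Omega} P T F n _.

Section Market.
Context {R : realType} {dsp : measure_display} {Omega : measurableType dsp}.
Variables (P : probability Omega R) (T : R) (F : R -> set_system Omega).
Context {D : nat}.
Variable Pi : R -> Omega -> 'M[R]_D.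

Definition bid_ask_process : Prop :=
  [/\ adapted T F Pi,
      forall w, cadlag T (Pi^~ w)
    & forall t w, 0 <= t -> t <= T -> bid_ask_matrix (Pi t w)].

Definition consistent_price_process (Z : R -> Omega -> 'rV[R]_D) : Prop :=
  [/\ martingale P T F Z,
      forall w, cadlag T (Z^~ w),
      forall t w, 0 <= t -> t <= T -> orthant (Z t w) /\ Z t w <> 0
    & forall t, 0 <= t -> t <= T ->
        \forall w \ae P, solvency_dual (Pi t w) (Z t w)].

Definition strictly_consistent : set (R -> Omega -> 'rV[R]_D) :=
  [set Z | [/\ consistent_price_process Z,
    forall tau, stopping_time T F tau ->
      \forall w \ae P, (tau w < +oo)%E ->
        (solvency_dual (at_time Pi tau w))^° (at_time Z tau w)
  & forall sigma, predictable_time T F sigma ->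
      \forall w \ae P, (sigma w < +oo)%E ->
        (solvency_dual (at_time (before Pi) sigma w))^°
          (at_time (before Z) sigma w)]].

Definition self_financing (V : R -> Omega -> 'rV[R]_D) : Prop :=
  [/\ predictable_process T F V,
      \forall w \ae P, forall i, bounded_variation 0 T (fun t => V t w 0 i)
    & forall sigma tau,
        finite_stopping_time T F sigma -> finite_stopping_time T F tau ->
        (forall w, (sigma w <= tau w)%E) ->
        \forall w \ae P,
          closed_convex_hull
            (\bigcup_(t in [set t : R | (sigma w <= t%:E)%E /\
                                        (t%:E < tau w)%E])
               solvency_cone (Pi t w) `|` [set 0])
            (- (at_time V tau w - at_time V sigma w))].

Definition admissible (V : R -> Omega -> 'rV[R]_D) : Prop :=
  exists a : R, [/\ 0 < a,
    \forall w \ae P, solvency_cone (Pi T w) (V T w + const_mx a)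
  & forall tau Z, finite_stopping_time T F tau -> strictly_consistent Z ->
      \forall w \ae P, 0 <= dot (at_time V tau w + const_mx a) (at_time Z tau w)].

Definition portfolios (x : 'rV[R]_D) : set (R -> Omega -> 'rV[R]_D) :=
  [set V | [/\ self_financing V, admissible V & \forall w \ae P, V 0 w = x]].

(* A_T^x *)
Definition terminal (x : 'rV[R]_D) : set (Omega -> 'rV[R]_D) :=
  [set V T | V in portfolios x].

(* the set C of the dual problem, and its polar D *)
Definition bounded_claims : set (Omega -> 'rV[R]_D) :=
  terminal 0 `&` Linfty P T F D.

Definition dual_variables : set (set Omega -> 'rV[R]_D) :=
  [set m | ba P T F D m /\ forall X, bounded_claims X -> ba_pairing m X <= 0].

Variables (d : nat) (leD : (d <= D)%N) (U : 'rV[R]_d -> \bar R).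
Local Open Scope ereal_scope.

Definition value_function (x : 'rV[R]_D) : \bar R :=
  ereal_sup [set expect P (extension leD U \o X) | X in terminal x].

(* U_x and its conjugate U_x^* *)
Definition primal (x : 'rV[R]_D) (X : Omega -> 'rV[R]_D) : \bar R :=
  expect P (fun w => extension leD U (x + X w)%R).

Definition conjugate (x : 'rV[R]_D) (m : set Omega -> 'rV[R]_D) : \bar R :=
  ereal_sup [set primal x X - (ba_pairing m X)%:E | X in Linfty P T F D].

End Market.

(* Main.v *)
Require Import Defs.
From HB Require Import structures.
From mathcomp Require Import all_boot all_order all_algebra.
From mathcomp Require Import all_classical all_reals all_analysis.
From mathcomp Require Import measurable_realfun ring lra.

Set Implicit Arguments.
Unset Strict Implicit.
Unset Printing Implicit Defensive.

Import Order.TTheory GRing.Theory Num.Theory.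
Import numFieldNormedType.Exports.

Local Open Scope classical_set_scope.
Local Open Scope ring_scope.

(* Write [s x] for the supremum of the utility over the bounded claims and [1]
   for the vector (1, ..., 1). If [X] is attainable from [x] with nonnegative
   values, then truncating [X + e 1] gives bounded claims whose utility is at
   least [U (e 1)], so [u x <= s (x + e 1)] by monotone convergence. Letting [e]
   tend to 0 yields the weak duality [u x <= U_x^* m], because [m] is Lipschitz
   for the sup norm, and [s = u] on [int (dom u)], because [s] is concave.
   On [int (dom u)] some bounded claim [X] satisfies [x + X >= e 1] for an
   [e > 0], so [Y |-> sup_C U_x (X + Y)] is concave and bounded from below near
   0, and Hahn-Banach provides a supergradient at 0, which solves the dual
   problem. If [x] is outside [cl (dom u)], then [- x] has positive distance to
   the bounded claims, since these are stable under throwing goods away; a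
   separating [m2] with [m2 x < 0] added to a dual element [m1] of finite value
   yields [U_x^* (m1 + l m2) --> -oo] as [l --> +oo]. *)

(** * Hahn-Banach separation *)

(** A pair [(x, r)] of a proper cone stands for the bound [L x <= r] on a linear [L] to be found,
    and the clause at 0 is the compatibility that linearity demands. The supergradient and the
    separating functional differ only in the cone of bounds; continuity for the essential sup norm
    is one more family of pairs in it. No quotient by null sets is formed: [L] acts on functions,
    and an essential bound with [c = 0] makes it vanish on the null ones. The shift by [e 1] is
    needed because [U] may be [-oo] on the boundary of the orthant: truncating a nonnegative
    terminal value can turn a finite expected utility into [-oo], whereas [U] is finite at [e 1].
    Since [U] is not assumed continuous, the truncations are chosen to reach their limit from some
    index on, not merely to converge to it. Outside the orthant the utility is [-oo], so every real
    lower bound on an expected utility yields almost sure nonnegativity. *)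

Definition proper_cone {R : realType} {V : lmodType R} (G : set (V * R)) :=
  [/\ forall x y r s, G (x, r) -> G (y, s) -> G (x + y, r + s),
      forall c x r, 0 < c -> G (x, r) -> G (c *: x, c * r)
    & forall r, G (0, r) -> 0 <= r].

(** Each clause involves at most two elements, so it passes to unions of chains. Zorn is applied to
    the sets [G] for which [B] joined with [G] is proper, and not to the cones containing [B], so
    that the empty chain causes no trouble. *)
Lemma maximal_proper_cone {R : realType} {V : lmodType R} (B : set (V * R)) :
  proper_cone B -> exists M, [/\ proper_cone M, B `<=` M &
    forall M', proper_cone M' -> M `<=` M' -> M' `<=` M].
Proof.
move=> pB.
have [|A [pA Amax]] := @Zorn_bigcup _ [set G | proper_cone (B `|` G)].
  move=> F FP Ftot /=.
  have common p q : (B `|` \bigcup_(X in F) X) p ->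
      (B `|` \bigcup_(X in F) X) q ->
      exists Z, [/\ proper_cone (B `|` Z), (B `|` Z) p, (B `|` Z) q
                  & B `|` Z `<=` B `|` \bigcup_(X in F) X].
    have sub Z : F Z -> B `|` Z `<=` B `|` \bigcup_(X in F) X.
      by move=> FZ; apply: setUS => z Zz; exists Z.
    move=> [Bp|[X FX Xp]] [Bq|[Y FY Yq]].
    - by exists set0; rewrite setU0; split.
    - by exists Y; split; [exact: FP|left|right|exact: sub].
    - by exists X; split; [exact: FP|right|left|exact: sub].
    - have [XY|YX] := Ftot _ _ FX FY.
      + by exists Y; split; [exact: FP|right; exact: XY|right|exact: sub].
      + by exists X; split; [exact: FP|right|right; exact: YX|exact: sub].
  split.
  - move=> x y r s Gx Gy; have [Z [[add _ _] Zx Zy ZG]] := common _ _ Gx Gy.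
    exact/ZG/add.
  - move=> c x r c0 Gx; have [Z [[_ sc _] Zx _ ZG]] := common _ _ Gx Gx.
    exact/ZG/sc.
  - move=> r G0; have [Z [[_ _ pos] Z0 _ _]] := common _ _ G0 G0.
    exact: pos.
exists (B `|` A); split; [exact: pA|by move=> z; left|].
move=> M' pM' AM'; have [M'A|M'A] := pselect (M' `<=` A).
  by move=> z /M'A; right.
exfalso; apply: (Amax M').
  split => // p Ap; apply: AM'; by right.
rewrite /= (_ : B `|` M' = M')//; apply/setUidPr => p Bp.
by apply: AM'; left.
Qed.

(* Maximality makes the cone contain, with every [x] of its symmetric domain,
   both [(x, r)] and [(- x, - r)], where [r] is the infimum of the fibre at
   [x]. *)
Lemma cone_functional {R : realType} {V : lmodType R} (B : set (V * R)) :
  proper_cone B ->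
  let E := [set x | (exists r, B (x, r)) /\ exists r, B (- x, r)] in
  exists L : V -> R,
    (forall a x y, E x -> E y -> L (a *: x + y) = a * L x + L y) /\
    (forall x r, E x -> B (x, r) -> L x <= r).
Proof.
move=> [Badd Bsc Bpos] E.
(* A proper cone is stable under positive factors only and need not contain 0; adjoining [(0, 0)]
   admits the factor 0. *)
pose B0 : set (V * R) := B `|` [set (0, 0)].
have pB0 : proper_cone B0.
  split.
  - move=> x y r s [Bx|[-> ->]] [By|[-> ->]];
    rewrite ?addr0 ?add0r; last by right.
    + by left; exact: Badd.
    + by left.
    + by left.
  - move=> c x r c0 [Bx|[-> ->]]; first by left; exact: Bsc.
    by right; rewrite scaler0 mulr0.
  - by move=> r [/Bpos//|[->]].
have [M [[Madd Msc Mpos] B0M Mmax]] := maximal_proper_cone pB0.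
have M00 : M (0, 0) by apply: B0M; right.
have BM p : B p -> M p by move=> ?; apply: B0M; left.
have Msc0 c x r : 0 <= c -> M (x, r) -> M (c *: x, c * r).
  rewrite le_eqVlt => /predU1P[<-|c0]; first by rewrite scale0r mul0r.
  exact: Msc.
pose g x r := M (x, r) /\ M (- x, - r).
have half x : E x -> exists i, [/\ M (- x, - i), forall r, M (x, r) -> i <= r
      & forall l, (forall r, M (x, r) -> l <= r) -> l <= i].
  move=> [[r0 Br0] [s0 Bs0]].
  pose A := [set r | M (x, r)].
  have A0 : A !=set0 by exists r0; exact: BM.
  have hA : has_inf A.
    split => //; exists (- s0) => r Mr; rewrite -subr_ge0 opprK; apply: Mpos.
    by rewrite -(subrr x); apply: Madd => //; exact: BM.
  pose i := inf A.
  have iA r : M (x, r) -> i <= r by move=> Mr; apply: ge_inf => //; case: hA.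
  (* [M'] is generated by [M] and [(- x, - i)]. It stays proper: if [y = c *: x] with [c > 0], then
     [t / c] lies in the fibre over [x] and is at least [i]. Maximality then puts [(- x, - i)] in
     [M]. *)
  pose M' : set (V * R) := [set p | exists c y t, [/\ 0 <= c, M (y, t) &
     p = (y - c *: x, t - c * i)]].
  have pM' : proper_cone M'.
    split.
    - move=> _ _ _ _ [c [y [t [c0 My [-> ->]]]]] [e [z [v [e0 Mz [-> ->]]]]].
      exists (c + e), (y + z), (t + v); split; [exact: addr_ge0|exact: Madd|].
      by congr pair; [rewrite scalerDl opprD addrACA|ring].
    - move=> k _ _ k0 [c [y [t [c0 My [-> ->]]]]].
      exists (k * c), (k *: y), (k * t).
      split; [by rewrite mulr_ge0// ltW|exact: Msc|].
      by congr pair; [rewrite scalerBr scalerA|ring].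
    - move=> r [c [y [t [c0 My [/esym/eqP + ->]]]]].
      rewrite subr_eq0 => /eqP yE; move: c0; rewrite le_eqVlt => /predU1P[cE|c0].
        by move: My; rewrite yE -cE scale0r mul0r subr0 => /Mpos.
      rewrite subr_ge0 mulrC -ler_pdivlMr//; apply: iA.
      have -> : x = c^-1 *: y by rewrite yE scalerA mulVf ?gt_eqF// scale1r.
      by rewrite mulrC; apply: Msc => //; rewrite invr_gt0.
  have M'M : M' `<=` M.
    apply: Mmax => // -[y t] My; exists 0, y, t; split => //.
    by rewrite scale0r mul0r !subr0.
  exists i; split => // [|l lA]; last exact: lb_le_inf.
  by apply: M'M; exists 1, 0, 0; split => //; rewrite scale1r mul1r !sub0r.
have gE x : E x -> exists2 r, g x r & forall s, B (x, s) -> r <= s.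
  move=> Ex; have [i [Mi iM iglb]] := half _ Ex.
  have Enx : E (- x) by case: Ex => [? ?]; split => //; rewrite opprK.
  have [j [Mj _ jglb]] := half _ Enx; rewrite opprK in Mj.
  (* The half obtained for [- x] says that [(x, - j)] is in [M]; with [i = - j] this is the missing
     pair [(x, i)]. *)
  have ij : i = - j.
    apply/eqP; rewrite eq_le iM//=; apply: iglb => r Mr.
    rewrite lerNl; apply: jglb => s Ms; rewrite -subr_ge0 opprK; apply: Mpos.
    by rewrite -(addNr x); exact: Madd.
  by exists i; [split => //; rewrite ij|move=> s /BM /iM].
have g_uniq x r s : g x r -> g x s -> r = s.
  move=> [a b] [c d]; apply/eqP; rewrite eq_le; apply/andP; split.
    by rewrite -subr_ge0; apply: Mpos; rewrite -(subrr x); exact: Madd.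
  by rewrite -subr_ge0; apply: Mpos; rewrite -(subrr x); exact: Madd.
have g_lin a x y r s : g x r -> g y s -> g (a *: x + y) (a * r + s).
  move=> [Mx Mnx] [My Mny].
  have [a0|a0] := leP 0 a.
    split; first by apply: Madd => //; exact: Msc0.
    by rewrite !opprD -scalerN -mulrN; apply: Madd => //; exact: Msc0.
  have na0 : 0 <= - a by rewrite oppr_ge0 ltW.
  split.
    rewrite -[a *: x]opprK -scaleNr -scalerN -[a * r]opprK -mulNr -mulrN.
    by apply: Madd => //; exact: Msc0.
  by rewrite !opprD -scaleNr -mulNr; apply: Madd => //; exact: Msc0.
exists (fun x => xget 0 [set r | g x r]); split.
  move=> a x y Ex Ey.
  have [r gx _] := gE _ Ex; have [s gy _] := gE _ Ey.
  have getE z t : g z t -> xget 0 [set r | g z r] = t.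
    by move=> gt; case: xgetP => [? -> /= /g_uniq|/(_ t)//]; exact.
  by rewrite (getE _ _ gx) (getE _ _ gy); apply: getE; exact: g_lin.
move=> x t Ex Bx; have [r gx rB] := gE _ Ex.
case: xgetP => [v -> /= /g_uniq -/(_ _ gx) ->|/(_ r)//]; exact: rB.
Qed.

(** * Measurability of vector-valued maps *)

Lemma row_norm_leP {R : realType} {n} (x : 'rV[R]_n) (e : R) :
  0 <= e -> `|x| <= e <-> forall i, `|x 0 i| <= e.
Proof.
move=> e0; rewrite -[`|x|]/(mx_norm x) mx_normrE; split=> [le i|le].
  by apply: le_trans le; apply: (le_bigmax _ (fun ij => `|x ij.1 ij.2|) (0, i)).
by apply: bigmax_le => // -[j i] _ /=; rewrite ord1.
Qed.

Lemma ler_row_norm {R : realType} {n} (x : 'rV[R]_n) i : `|x 0 i| <= `|x|.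
Proof. by have /row_norm_leP := lexx `|x|; apply. Qed.

Lemma row_ballP {R : realType} {n} (x y : 'rV[R]_n) (e : R) : 0 < e ->
  ball x e y <-> forall i, `|x 0 i - y 0 i| < e.
Proof.
move=> e0; split => [[_ xy] i|xy]; first exact: xy.
by split=> // j i; rewrite ord1; exact: xy.
Qed.

Lemma natSinv_lt {R : realType} (e : R) : 0 < e -> exists k, k.+1%:R^-1 < e.
Proof.
move=> e0; have [k _ /(_ k (leqnn k)) ke] := near_infty_natSinv_lt (PosNum e0).
by exists k.
Qed.

Section MeasurableFor.
Context {R : realType} {A : pointedType} {G : set_system A}.
Hypothesis sG : sigma_algebra setT G.

Lemma sigmaT : G setT.
Proof. by case: sG => G0 GC _; rewrite -(setD0 setT); exact: GC. Qed.

Lemma sigmaC B : G B -> G (~` B).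
Proof. by case: sG => _ GC _ GB; rewrite -setTD; exact: GC. Qed.

Lemma sigma_bigcup (B : (set A)^nat) : (forall n, G (B n)) -> G (\bigcup_n B n).
Proof. by case: sG => _ _; apply. Qed.

Lemma sigmaI B C : G B -> G C -> G (B `&` C).
Proof.
rewrite -(measurable_g_measurableTypeE sG); exact: measurableI.
Qed.

Lemma sigmaU B C : G B -> G C -> G (B `|` C).
Proof.
rewrite -(measurable_g_measurableTypeE sG); exact: measurableU.
Qed.

Lemma measurable_for_opens (E : topologicalType) (X : A -> E) :
  (forall B, open B -> G (X @^-1` B)) -> measurable_for G X.
Proof.
move=> XO B; apply: (smallest_sub (C := sigma_algebra setT)
  (X := [set B | G (X @^-1` B)])) => //; split => /=.
- by rewrite preimage_set0; case: sG.
- by move=> C GC; rewrite setTD preimage_setC; exact: sigmaC.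
- by move=> C GC; rewrite preimage_bigcup; exact: sigma_bigcup.
Qed.

Lemma measurable_for_open (E : topologicalType) (X : A -> E) B :
  measurable_for G X -> open B -> G (X @^-1` B).
Proof. by move=> mX oB; apply: mX; exact: sub_gen_smallest. Qed.

Lemma measurable_for_realP (f : A -> R) : measurable_for G f <->
  measurable_fun [set: g_sigma_algebraType G] (f : g_sigma_algebraType G -> R).
Proof.
split => mf.
  apply: (measurability _ (RGenOInfty.measurableE R)) => _ [_ [a ->] <-].
  rewrite setTI measurable_g_measurableTypeE//.
  by apply: measurable_for_open => //; exact: itv_open_ends_open.
apply: measurable_for_opens => B oB.
rewrite -[X in X _](measurable_g_measurableTypeE sG) -[X in measurable X]setTI.
by apply: mf => //; exact: open_measurable.
Qed.

Lemma measurable_for_rowP n (X : A -> 'rV[R]_n) : measurable_for G X <->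
  forall i, measurable_for G (fun w => X w 0 i).
Proof.
split => [mX i|mX].
  apply: measurable_for_opens => B oB.
  rewrite (_ : _ @^-1` _ = X @^-1` ((fun x : 'rV[R]_n => x 0 i) @^-1` B))//.
  apply: measurable_for_open => //.
  by apply: open_comp => // x _; exact: coord_continuous.
apply: measurable_for_opens => B oB.
(* Sup-norm balls with rational centre and radius [1 / (k + 1)] form a countable base, and the
   preimage of such a ball is a finite intersection of coordinate preimages. *)
pose I := ('rV[rat]_n * nat)%type.
pose c (p : I) : 'rV[R]_n := map_mx ratr p.1.
pose D := [set p : I | ball (c p) p.2.+1%:R^-1 `<=` B].
have BE : B = \bigcup_(p in D) ball (c p) p.2.+1%:R^-1.
  apply/seteqP; split => [x Bx|x [p Dp]]; last exact: Dp.
  have /nbhs_ballP[e /= e0 eB] : nbhs x B by apply: open_nbhs_nbhs.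
  have [k ke] : exists k, k.+1%:R^-1 < e / 2 by apply: natSinv_lt; lra.
  have k0 : 0 < k.+1%:R^-1 :> R by rewrite invr_gt0.
  have [q qx] : exists q : 'rV[rat]_n,
      ball x k.+1%:R^-1 (map_mx ratr q : 'rV[R]_n).
    have h i : exists q : rat, `|x 0 i - ratr q| < k.+1%:R^-1.
      have [|q /andP[]] := @rat_in_itvoo R (x 0 i) (x 0 i + k.+1%:R^-1).
        by rewrite ltrDl.
      by exists q; rewrite distrC ger0_norm ?subr_ge0 1?ltW// ltrBlDl.
    have [q qx] := choice h.
    exists (\row_i q i); apply/row_ballP => // i; rewrite !mxE; exact: qx.
  exists (q, k) => /=; last exact: ball_sym.
  move=> z /= zq; apply: eB; apply: (@le_ball _ _ _ (k.+1%:R^-1 + k.+1%:R^-1)).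
    by rewrite (splitr e) lerD// ltW.
  exact: ball_triangle qx zq.
rewrite BE preimage_bigcup.
pose F k := if unpickle k is Some p then
  if `[< D p >] then X @^-1` ball (c p) (p : I).2.+1%:R^-1 else set0 else set0.
rewrite (_ : \bigcup_(p in D) _ = \bigcup_k F k); last first.
  apply/seteqP; split => [w [p Dp pw]|w [k _]].
    by exists (pickle p) => //; rewrite /F pickleK asboolT.
  rewrite /F; case: unpickle => // p; case: asboolP => // Dp pw.
  by exists p.
apply: sigma_bigcup => k; rewrite /F.
case: unpickle => [p|]; last by case: sG.
case: asboolP => _; last by case: sG.
rewrite (_ : _ @^-1` _ = \bigcap_(i in [set: 'I_n])
    (fun w => X w 0 i) @^-1` ball (c p 0 i) p.2.+1%:R^-1).
  rewrite -(measurable_g_measurableTypeE sG).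
  apply: fin_bigcap_measurable => // i _.
  rewrite measurable_g_measurableTypeE//.
  by apply: measurable_for_open => //; exact: ball_open.
have k0 : 0 < p.2.+1%:R^-1 :> R by rewrite invr_gt0.
apply/seteqP; split => w /=.
  by move=> /(row_ballP _ _ k0) h i _; exact: h.
by move=> h; apply/row_ballP => // i; exact: h.
Qed.

Lemma measurable_for_cst (E : topologicalType) (x : E) :
  measurable_for G (fun=> x).
Proof.
apply: measurable_for_opens => B _.
rewrite preimage_cst; case: ifPn => _; [exact: sigmaT|by case: sG].
Qed.

Lemma measurable_for_lin n (a b : R) (X Y : A -> 'rV[R]_n) :
  measurable_for G X -> measurable_for G Y ->
  measurable_for G (fun w => a *: X w + b *: Y w).
Proof.
move=> /measurable_for_rowP mX /measurable_for_rowP mY.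
apply/measurable_for_rowP => i.
rewrite (_ : (fun w => _) = (fun w => a * X w 0 i + b * Y w 0 i)); last first.
  by apply/funext => w; rewrite !mxE.
apply/measurable_for_realP; apply: measurable_funD.
  by apply: measurable_funM => //; exact/measurable_for_realP.
by apply: measurable_funM => //; exact/measurable_for_realP.
Qed.

Lemma measurable_for_D n (X Y : A -> 'rV[R]_n) :
  measurable_for G X -> measurable_for G Y ->
  measurable_for G (fun w => X w + Y w).
Proof.
move=> mX mY; under eq_fun do rewrite -[X _]scale1r -[Y _]scale1r.
exact: measurable_for_lin.
Qed.

Lemma measurable_for_min n (c : R) (X : A -> 'rV[R]_n) :
  measurable_for G X ->
  measurable_for G (fun w => map_mx (fun r => Num.min r c) (X w)).
Proof.
move=> /measurable_for_rowP mX; apply/measurable_for_rowP => i.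
under eq_fun do rewrite mxE.
apply/measurable_for_realP; apply: measurable_minr => //.
exact/measurable_for_realP.
Qed.

Lemma measurable_for_if (E : topologicalType) B (X Y : A -> E) :
  G B -> measurable_for G X -> measurable_for G Y ->
  measurable_for G (fun w => if w \in B then X w else Y w).
Proof.
move=> GB mX mY; apply: measurable_for_opens => C oC.
rewrite (_ : _ @^-1` _ = (B `&` X @^-1` C) `|` (~` B `&` Y @^-1` C)).
  apply: sigmaU; apply: sigmaI; rewrite //; try exact: sigmaC;
  exact: measurable_for_open.
apply/seteqP; split => w /=.
  by case: ifPn => [/set_mem|/negP wB]; [left|right; split => // /mem_set].
by move=> [[wB]|[wB]]; rewrite ?(mem_set wB)// memNset.
Qed.

End MeasurableFor.

(** * Integration against finitely additive measures *)

Section FiniteAdditivity.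
Context {R : realType} {dsp : measure_display} {Omega : measurableType dsp}.
Context {P : probability Omega R} {G : set_system Omega}.
Hypothesis sG : sigma_algebra setT G.
Hypothesis Gm : G `<=` measurable.
Context {mu : set Omega -> R} {M : R}.
Hypothesis mu_add : forall A B, G A -> G B -> A `&` B = set0 ->
  mu (A `|` B) = mu A + mu B.
Hypothesis mu_bnd : forall A, G A -> `|mu A| <= M.
Hypothesis mu_null : forall A, G A -> P A = 0%E -> mu A = 0.

Let G0 : G set0. Proof. by case: sG. Qed.

Lemma fa_set0 : mu set0 = 0.
Proof. by apply: mu_null => //; rewrite measure0. Qed.

Lemma fa_bnd_ge0 : 0 <= M.
Proof. exact: le_trans (normr_ge0 _) (mu_bnd G0). Qed.


Lemma fa_bigU (I : eqType) (r : seq I) (p : pred I) (A : I -> set Omega) :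
  uniq r -> (forall i, G (A i)) -> trivIset setT A ->
  G [set w | exists i, [/\ i \in r, p i & A i w]] /\
  \sum_(i <- r | p i) mu (A i) = mu [set w | exists i, [/\ i \in r, p i & A i w]].
Proof.
move=> + GA tA; elim: r => [_|i r IH /= /andP[ir ur]].
  rewrite big_nil (_ : [set w | _] = set0) ?fa_set0//.
  by apply/seteqP; split => // w [? []].
have [Gr Er] := IH ur; rewrite big_cons.
case: ifPn => pi; last first.
  rewrite Er (_ : [set w | exists i0, [/\ i0 \in i :: r, _ & _]] =
    [set w | exists i0, [/\ i0 \in r, p i0 & A i0 w]])//.
  apply/seteqP; split => w [j [jr pj Ajw]]; exists j; split => //.
    by move: jr pj; rewrite inE => /predU1P[->|//]; rewrite (negbTE pi).
  by rewrite inE jr orbT.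
rewrite Er -mu_add//; last first.
  apply/seteqP; split => // w [Aiw [j [jr pj Ajw]]].
  have ij : i = j by apply: tA => //; exists w.
  by move: ir; rewrite ij jr.
rewrite (_ : [set w | exists i0, [/\ i0 \in i :: r, _ & _]] =
  A i `|` [set w | exists i0, [/\ i0 \in r, p i0 & A i0 w]]); last first.
  apply/seteqP; split => w.
    move=> [j [+ pj Ajw]]; rewrite inE => /predU1P[<-|jr]; [by left|right].
    by exists j.
  move=> [Aiw|[j [jr pj Ajw]]]; first by exists i; rewrite inE eqxx.
  by exists j; rewrite inE jr orbT.
by split => //; exact: (sigmaU sG).
Qed.

(** Grouping the cells by the sign of [mu] turns each half of the sum into plus or minus the measure
    of a single set, hence the factor 2. *)
Lemma fa_variation (I : finType) (A : I -> set Omega) :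
  (forall i, G (A i)) -> trivIset setT A -> \sum_i `|mu (A i)| <= 2 * M.
Proof.
move=> GA tA; rewrite (bigID (fun i => 0 <= mu (A i)))/=.
have := fa_bigU (fun i => 0 <= mu (A i)) (index_enum_uniq I) GA tA.
have := fa_bigU (fun i => ~~ (0 <= mu (A i))) (index_enum_uniq I) GA tA.
set B := [set w | _]; set C := [set w | _] => -[GB EB] [GC EC].
have -> : \sum_(i | 0 <= mu (A i)) `|mu (A i)| = mu C.
  by rewrite -EC; apply: eq_bigr => i i0; rewrite ger0_norm.
have -> : \sum_(i | ~~ (0 <= mu (A i))) `|mu (A i)| = - mu B.
  rewrite -EB -sumrN; apply: eq_bigr => i; rewrite -ltNge => i0.
  by rewrite ltr0_norm.
have := mu_bnd GB; have := mu_bnd GC; rewrite !ler_norml => /andP[? ?] /andP[? ?].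
lra.
Qed.

Lemma fa_sum_le (I : finType) (A : I -> set Omega) (c : I -> R) (e : R) :
  (forall i, G (A i)) -> trivIset setT A -> 0 <= e ->
  (forall i, P (A i) = 0%E \/ `|c i| <= e) ->
  `|\sum_i c i * mu (A i)| <= e * (2 * M).
Proof.
move=> GA tA e0 ce; apply: (le_trans (ler_norm_sum _ _ _)).
apply: (@le_trans _ _ (\sum_i e * `|mu (A i)|)).
  apply: ler_sum => i _; rewrite normrM.
  by have [/(mu_null (GA i)) ->|h] := ce i; rewrite ?normr0 ?mulr0// ler_wpM2r.
by rewrite -mulr_sumr ler_wpM2l// fa_variation.
Qed.

(** Covering is asked only almost surely: the cells of [fa_sum] cover just the values in [[- n, n[],
    and the integrands are only essentially bounded. *)
Definition ae_partition (I : finType) (A : I -> set Omega) :=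
  [/\ forall i, G (A i), trivIset setT A & \forall w \ae P, exists i, A i w].

Lemma fa_split (J : finType) (B : J -> set Omega) A : ae_partition B -> G A ->
  mu A = \sum_j mu (A `&` B j).
Proof.
move=> [GB tB cB] GA.
have GAB j : G (A `&` B j) by exact: (sigmaI sG).
have [|GU ->] := fa_bigU predT (index_enum_uniq J) GAB _.
  by move=> i j _ _ [w [[_ Bi] [_ Bj]]]; apply: tB => //; exists w.
set U := [set w | _].
have UA : U `<=` A by move=> w [j [_ _ []]].
have GD : G (A `&` ~` U) by apply: (sigmaI sG) => //; exact: (sigmaC sG).
have -> : A = U `|` (A `&` ~` U).
  by rewrite setUIr setUv setIT; apply/esym/setUidPr.
rewrite mu_add//; last by rewrite setICA setICr setI0.
rewrite [X in _ + X]mu_null ?addr0//.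
apply/eqP; rewrite -measure_le0.
have [N [mN PN NB]] := cB.
rewrite -PN; apply: le_measure; rewrite ?inE//; first exact: Gm.
move=> w [Aw nU]; apply: NB => -[j Bj]; apply: nU.
by exists j; split => //; rewrite mem_index_enum.
Qed.

(** Both sums are rewritten over the common refinement, where the coefficients differ by at most [e]
    unless the cell is null. *)
Lemma fa_partition_le (I J : finType) (A : I -> set Omega) (B : J -> set Omega)
    (a : I -> R) (b : J -> R) (e : R) :
  ae_partition A -> ae_partition B -> 0 <= e ->
  (forall i j, P (A i `&` B j) = 0%E \/ `|a i - b j| <= e) ->
  `|\sum_i a i * mu (A i) - \sum_j b j * mu (B j)| <= e * (2 * M).
Proof.
move=> pA pB e0 ab; have [GA tA _] := pA; have [GB tB _] := pB.
have -> : \sum_i a i * mu (A i) - \sum_j b j * mu (B j) =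
    \sum_(p : I * J) (a p.1 - b p.2) * mu (A p.1 `&` B p.2).
  rewrite -(pair_bigA _ (fun i j => (a i - b j) * mu (A i `&` B j)))/=.
  under [RHS]eq_bigr do under eq_bigr do rewrite mulrBl.
  under [RHS]eq_bigr do rewrite sumrB.
  rewrite sumrB; congr (_ - _).
    by apply: eq_bigr => i _; rewrite -mulr_sumr -fa_split.
  rewrite exchange_big/=; apply: eq_bigr => j _; rewrite -mulr_sumr.
  by under eq_bigr do rewrite setIC; rewrite -fa_split.
apply: fa_sum_le => //.
- by move=> p; exact: (sigmaI sG).
- move=> [i j] [i' j'] _ _ [w [[/= Ai Bj] [Ai' Bj']]].
  by congr pair; [apply: tA|apply: tB] => //; exists w.
Qed.

Definition fa_level (n k : nat) : R := (k%:R - (n * n)%:R) / n%:R.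

Definition fa_cell (f : Omega -> R) (n k : nat) : set Omega :=
  [set w | fa_level n k <= f w /\ f w < fa_level n k.+1].

Lemma fa_sumE f n :
  fa_sum mu f n = \sum_(k < n * n + n * n) fa_level n k * mu (fa_cell f n k).
Proof. by rewrite /fa_sum big_mkord. Qed.

Lemma fa_levelS n k : fa_level n k.+1 = fa_level n k + n%:R^-1.
Proof. by rewrite /fa_level -natr1 addrAC mulrDl mul1r. Qed.

Lemma fa_level_lt n k l : (0 < n)%N ->
  (fa_level n k < fa_level n l.+1) = (k <= l)%N.
Proof.
move=> n0; rewrite /fa_level ltr_pM2r ?invr_gt0 ?ltr0n//.
by rewrite ltrD2r ltr_nat ltnS.
Qed.

Lemma fa_cell_partition f n (K : R) :
  (forall a b, G [set w | a <= f w /\ f w < b]) ->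
  (\forall w \ae P, `|f w| <= K) -> K < n%:R ->
  ae_partition (fun k : 'I_(n * n + n * n) => fa_cell f n k).
Proof.
move=> mf fK Kn; split => [k| |]; first exact: mf.
  move=> i j _ _ [w [[ilo ihi] [jlo jhi]]]; apply/val_inj/eqP => /=.
  have n0 : (0 < n)%N.
    by have := leq_ltn_trans (leq0n _) (ltn_ord i); case: (n).
  rewrite eqn_leq -!(fa_level_lt _ _ n0).
  by rewrite (le_lt_trans ilo)// (le_lt_trans jlo).
apply: filterS fK => w fwK.
have K0 : 0 <= K by exact: le_trans fwK.
have n0 : 0 < n%:R :> R by exact: le_lt_trans Kn.
have /ltr_normlP[flo fhi] := le_lt_trans fwK Kn.
(* [fa_level n k <= f w] means [k <= x], so the cell containing [w] has the integer part of [x] as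
   its index. *)
pose x := f w * n%:R + (n * n)%:R.
have x0 : 0 <= x.
  by rewrite /x natrM -mulrDl mulr_ge0// ?ltW//; lra.
have /andP[klo khi] := truncn_itv x0.
have kb : (Num.truncn x < n * n + n * n)%N.
  rewrite -(ltr_nat R); apply: (le_lt_trans klo).
  by rewrite /x natrD ltrD2r natrM ltr_pM2r.
exists (Ordinal kb); split => /=.
  by rewrite /fa_level ler_pdivrMr// lerBlDr.
by rewrite /fa_level ltr_pdivlMr// ltrBrDr.
Qed.

Lemma fa_sum_close f g (K e : R) n m :
  (forall a b, G [set w | a <= f w /\ f w < b]) ->
  (forall a b, G [set w | a <= g w /\ g w < b]) ->
  (\forall w \ae P, `|f w| <= K) -> (\forall w \ae P, `|g w| <= K) ->
  0 <= e -> (\forall w \ae P, `|f w - g w| <= e) ->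
  K < n%:R -> K < m%:R ->
  `|fa_sum mu f n - fa_sum mu g m| <= (e + n%:R^-1 + m%:R^-1) * (2 * M).
Proof.
move=> mf mg fK gK e0 fg Kn Km; rewrite !fa_sumE.
have n0 : 0 <= n%:R^-1 :> R by rewrite invr_ge0.
have m0 : 0 <= m%:R^-1 :> R by rewrite invr_ge0.
apply: fa_partition_le; [exact: fa_cell_partition fK Kn|
  exact: fa_cell_partition gK Km|by rewrite !addr_ge0|].
(* Either the two cells share a point where [f] and [g] are [e]-close, and their levels differ by at
   most [e] plus the two mesh sizes, or their intersection lies in a null set. *)
move=> i j; have [fgij|fgij] := pselect (exists w,
    [/\ fa_cell f n i w, fa_cell g m j w & `|f w - g w| <= e]).
  right; have [w [[]]] := fgij; rewrite /fa_cell /= !fa_levelS => ? ? [? ?].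
  by rewrite !ler_norml => /andP[? ?]; apply/andP; lra.
left; apply/eqP; rewrite -measure_le0; have [N [mN PN NB]] := fg.
rewrite -PN; apply: le_measure; rewrite ?inE//.
  by apply/Gm/(sigmaI sG); [exact: mf|exact: mg].
by move=> w [fw gw]; apply: NB => fgw; apply: fgij; exists w.
Qed.

Lemma fa_sum_lim f (K : R) : (forall a b, G [set w | a <= f w /\ f w < b]) ->
  (\forall w \ae P, `|f w| <= K) ->
  (forall n, K < n%:R ->
    `|fa_sum mu f n - fa_integral mu f| <= n%:R^-1 * (2 * M)) /\
  fa_sum mu f n @[n --> \oo] --> fa_integral mu f.
Proof.
move=> mf fK.
have close n m : K < n%:R -> K < m%:R ->
    `|fa_sum mu f n - fa_sum mu f m| <= (n%:R^-1 + m%:R^-1) * (2 * M).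
  move=> Kn Km; rewrite -[n%:R^-1]add0r; apply: (fa_sum_close mf mf fK fK) => //.
  by apply/nearW => w; rewrite subrr normr0.
pose c n := n%:R^-1 * (2 * M).
(* By [close], the intervals of radius [c n] around the sums meet pairwise, so the supremum of their
   left ends lies in all of them. This gives the limit together with a rate. *)
pose A := [set x | exists n, K < n%:R /\ x = fa_sum mu f n - c n].
have Aub n : K < n%:R -> ubound A (fa_sum mu f n + c n).
  move=> Kn _ [m [Km ->]]; have := close _ _ Kn Km.
  by rewrite mulrDl -/(c n) -/(c m) ler_norml => /andP[? ?]; lra.
pose l := sup A.
have [n0 Kn0] : exists n, K < n%:R.
  by exists (Num.truncn K).+1; exact: truncnS_gt.
have lclose n : K < n%:R -> `|fa_sum mu f n - l| <= c n.
  move=> Kn; rewrite ler_distlC; apply/andP; split.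
    by apply: ub_le_sup; [exists (fa_sum mu f n + c n); exact: Aub|exists n].
  by apply: ge_sup; [exists (fa_sum mu f n - c n), n|exact: Aub].
have fl : fa_sum mu f n @[n --> \oo] --> l.
  apply/cvgrPdist_le => e e0.
  have M1 : 0 < 2 * M + 1 by rewrite ltr_wpDl// mulr_ge0// fa_bnd_ge0.
  near=> n; rewrite distrC; apply: le_trans (lclose n _) _.
    by near: n; exact: nbhs_infty_gtr.
  rewrite /c mulrC -ler_pdivlMr ?invr_gt0 ?invrK//; last first.
    by rewrite ltr0n; near: n; exists 1%N.
  have ne : (2 * M + 1) / e <= n%:R by near: n; exact: nbhs_infty_ger.
  move: ne; rewrite ler_pdivrMr// => ne; rewrite mulrC; lra.
have -> : fa_integral mu f = l by apply: cvg_lim.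
by split.
Unshelve. all: by end_near. Qed.

Lemma fa_integral_lipschitz f g (K e : R) :
  (forall a b, G [set w | a <= f w /\ f w < b]) ->
  (forall a b, G [set w | a <= g w /\ g w < b]) ->
  (\forall w \ae P, `|f w| <= K) -> (\forall w \ae P, `|g w| <= K) ->
  0 <= e -> (\forall w \ae P, `|f w - g w| <= e) ->
  `|fa_integral mu f - fa_integral mu g| <= e * (2 * M).
Proof.
move=> mf mg fK gK e0 fg.
have [_ cf] := fa_sum_lim mf fK; have [_ cg] := fa_sum_lim mg gK.
have c1 : `|fa_sum mu f n - fa_sum mu g n| @[n --> \oo] -->
    `|fa_integral mu f - fa_integral mu g|.
  by apply: cvg_norm; exact: cvgB.
have cinv : n%:R^-1 @[n --> \oo] --> (0 : R).
  apply/cvgrPdist_le => d d0; near=> n.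
  rewrite sub0r normrN ger0_norm ?invr_ge0//.
  rewrite -[d]invrK lef_pV2 ?posrE ?invr_gt0//; last first.
    by rewrite ltr0n; near: n; exists 1%N.
  by near: n; exact: nbhs_infty_ger.
have c2 : (e + n%:R^-1 + n%:R^-1) * (2 * M) @[n --> \oo] -->
    (e + 0 + 0) * (2 * M).
  by apply: cvgMl; apply: cvgD => //; apply: cvgD => //; exact: cvg_cst.
rewrite -[e]addr0 -[e + 0]addr0; apply: (ler_cvg_to c1 c2).
near=> n; apply: (fa_sum_close mf mg fK gK) => //; near: n; exact: nbhs_infty_gtr.
Unshelve. all: by end_near. Qed.

End FiniteAdditivity.

(** * Bounded functionals as finitely additive measures *)

Section BoundedClaimsDual.
Context {R : realType} {dsp : measure_display} {Omega : measurableType dsp}.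
Context {P : probability Omega R} {T : R} {F : R -> set_system Omega}.
Hypothesis sG : sigma_algebra setT (F T).
Hypothesis Gm : F T `<=` measurable.
Context {n : nat}.
Local Notation Linf := (Linfty P T F n).

Lemma Linfty_lin (a b : R) X Y : Linf X -> Linf Y -> Linf (a *: X + b *: Y).
Proof.
move=> [mX [K XK]] [mY [J YJ]]; split; first exact: (measurable_for_lin sG).
exists (`|a| * K + `|b| * J); apply: filterS2 XK YJ => w XK YJ.
rewrite (le_trans (ler_normD _ _))// lerD//= normrZ; exact: ler_wpM2l.
Qed.

Lemma Linfty_cst x : Linf (cst x).
Proof.
split; first exact: (measurable_for_cst sG).
by exists `|x|; exact/nearW.
Qed.

Lemma LinftyZ a X : Linf X -> Linf (a *: X).
Proof. by move=> LX; rewrite -[_ *: _]addr0 -(scale0r X); exact: Linfty_lin. Qed.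

Lemma LinftyD X Y : Linf X -> Linf Y -> Linf (X + Y).
Proof. by move=> ? ?; rewrite -[X]scale1r -[Y]scale1r; exact: Linfty_lin. Qed.

Lemma LinftyN X : Linf X -> Linf (- X).
Proof. by rewrite -scaleN1r; exact: LinftyZ. Qed.

Lemma LinftyB X Y : Linf X -> Linf Y -> Linf (X - Y).
Proof. by move=> ? ?; apply: LinftyD => //; exact: LinftyN. Qed.

Lemma Linfty_sum I (r : seq I) (p : pred I) X : (forall i, p i -> Linf (X i)) ->
  Linf (\sum_(i <- r | p i) X i).
Proof.
by move=> LX; apply: big_ind => //; [exact: Linfty_cst|exact: LinftyD].
Qed.

Lemma Linfty_step A x : F T A -> Linf (fun w => if w \in A then x else 0).
Proof.
move=> GA; split.
  by apply: (measurable_for_if sG) => //; exact: (measurable_for_cst sG).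
by exists `|x|; apply/nearW => w; case: ifP => // _; rewrite normr0.
Qed.

Lemma measurable_levels (X : Omega -> 'rV[R]_n) (i : 'I_n) (a b : R) :
  measurable_for (F T) X ->
  F T [set w | a <= X w 0 i /\ X w 0 i < b].
Proof.
move=> /(measurable_for_rowP sG)/(_ i) mX.
rewrite (_ : [set w | _] = ~` [set w | X w 0 i < a] `&` [set w | X w 0 i < b]).
  have lt c : F T [set w | X w 0 i < c].
    have := measurable_for_open mX (@lray_open _ R c).
    by congr (F T _); apply/seteqP; split => w; rewrite /= in_itv.
  by apply: (sigmaI sG) => //; exact: (sigmaC sG).
by apply/seteqP; split => w /=; rewrite leNgt => -[] /negP.
Qed.

Lemma Linfty_coord X i : Linf X ->
  Linf (fun w => X w 0 i *: delta_mx 0 i).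
Proof.
move=> [mX [K XK]]; split.
  apply/(measurable_for_rowP sG) => j.
  have [<-|ij] := eqVneq i j.
    under eq_fun do rewrite !mxE !eqxx mulr1.
    exact: (measurable_for_rowP sG X).1.
  under eq_fun do rewrite !mxE !eqxx eq_sym (negbTE ij) mulr0.
  exact: (measurable_for_cst sG).
exists (K * `|delta_mx 0 i : 'rV[R]_n|); apply: filterS XK => w XwK.
rewrite normrZ ler_wpM2r// (le_trans _ XwK)//; exact: ler_row_norm.
Qed.

Lemma norm_basis_vec (i : 'I_n) : `|delta_mx 0 i : 'rV[R]_n| <= 1.
Proof.
apply/row_norm_leP => // j; rewrite mxE eqxx /=.
by case: eqP => _; rewrite ?normr1 ?normr0.
Qed.

Lemma ba_pairing_lipschitz m : ba P T F n m ->
  exists2 C, 0 <= C & forall X Y e, Linf X -> Linf Y -> 0 <= e ->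
    (\forall w \ae P, `|X w - Y w| <= e) ->
    `|ba_pairing m X - ba_pairing m Y| <= C * e.
Proof.
move=> [madd [M mM] mnull].
have M0 : 0 <= M by apply: le_trans (mM set0 _) => //; case: sG.
exists (n%:R * (2 * M)); first by rewrite !mulr_ge0.
move=> X Y e [mX [K XK]] [mY [J YJ]] e0 XY.
rewrite /ba_pairing -sumrB.
apply: (le_trans (ler_norm_sum _ _ _)).
rewrite (_ : _ * e = \sum_(i < n) e * (2 * M)); last first.
  by rewrite sumr_const card_ord -mulr_natl; ring.
apply: ler_sum => i _.
apply: (@fa_integral_lipschitz _ _ _ P _ sG Gm _ M _ _ _ _ _
  (Num.max K J)) => //.
- by move=> A B GA GB AB; rewrite madd// mxE.
- by move=> A GA; apply: le_trans (ler_row_norm _ _) (mM _ GA).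
- by move=> A GA PA; rewrite mnull// mxE.
- by move=> a b; exact: measurable_levels.
- by move=> a b; exact: measurable_levels.
- apply: filterS XK => w XK; rewrite le_max; apply/orP; left.
  exact: le_trans (ler_row_norm _ _) XK.
- apply: filterS YJ => w YJ; rewrite le_max; apply/orP; right.
  exact: le_trans (ler_row_norm _ _) YJ.
- apply: filterS XY => w XY; apply: le_trans XY.
  by have := ler_row_norm (X w - Y w) i; rewrite !mxE.
Qed.

Definition functional_measure (L : (Omega -> 'rV[R]_n) -> R) (A : set Omega) :
    'rV[R]_n :=
  \row_i L (fun w => if w \in A then delta_mx 0 i else 0).

Section Representation.
Context {L : (Omega -> 'rV[R]_n) -> R} {K : R}.
Hypothesis Llin : forall a X Y,
  Linf X -> Linf Y -> L (a *: X + Y) = a * L X + L Y.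
Hypothesis Lbnd : forall X c,
  Linf X -> 0 <= c -> (\forall w \ae P, `|X w| <= c) ->
  L X <= K * c.

Let L0 : L 0 = 0.
Proof.
have := Llin 1 (Linfty_cst 0) (Linfty_cst 0).
rewrite -[cst 0]/(0 : Omega -> 'rV[R]_n) scaler0 addr0 mul1r => /eqP.
by rewrite -subr_eq0 opprD addrA subrr sub0r oppr_eq0 => /eqP.
Qed.

Let LZ a X : Linf X -> L (a *: X) = a * L X.
Proof.
by move=> LX; rewrite -[a *: X]addr0 Llin ?L0 ?addr0//; exact: Linfty_cst.
Qed.

Let LD X Y : Linf X -> Linf Y -> L (X + Y) = L X + L Y.
Proof. by move=> LX LY; rewrite -[X]scale1r Llin// mul1r scale1r. Qed.

Let LB X Y : Linf X -> Linf Y -> L (X - Y) = L X - L Y.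
Proof.
by move=> LX LY; rewrite LD//; [rewrite -scaleN1r LZ// mulN1r|exact: LinftyN].
Qed.

Let Lsum I (r : seq I) X : (forall i, Linf (X i)) ->
  L (\sum_(i <- r) X i) = \sum_(i <- r) L (X i).
Proof.
move=> LX; elim: r => [|i r IH]; first by rewrite !big_nil L0.
by rewrite !big_cons LD ?IH//; exact: Linfty_sum.
Qed.

Let Labs X c : Linf X -> 0 <= c -> (\forall w \ae P, `|X w| <= c) ->
  `|L X| <= K * c.
Proof.
move=> LX c0 Xc; rewrite ler_norml Lbnd// andbT lerNl -mulN1r -LZ// Lbnd//.
  exact: LinftyZ.
by apply: filterS Xc => w; rewrite scaleN1r /= normrN.
Qed.

Lemma functional_measure_ba : ba P T F n (functional_measure L).
Proof.
split.
- move=> A B GA GB AB; apply/rowP => i; rewrite !mxE -LD; last 2 first.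
    exact: Linfty_step.
    exact: Linfty_step.
  congr L; apply/funext => w; rewrite !fctE in_setU.
  case: (boolP (w \in A)) => [/set_mem wA|]; last by rewrite /= add0r.
  rewrite memNset ?addr0// => wB.
  by have : set0 w by rewrite -AB.
- exists (K * 1) => A GA; apply/row_norm_leP; last first.
    move=> i; rewrite mxE; apply: Labs => //; first exact: Linfty_step.
    apply/nearW => w; case: ifP => _; last by rewrite normr0.
    exact: norm_basis_vec.
  apply: le_trans (normr_ge0 (L 0)) (Labs (Linfty_cst 0) ler01 _).
  by apply/nearW => w; rewrite normr0.
(* A step over a null set is essentially bounded by 0, so the bound with [c = 0] makes [L] vanish on
   it. *)
- move=> A GA PA; apply/rowP => i; rewrite !mxE; apply/eqP.
  rewrite -normr_le0 -(mulr0 K); apply: Labs => //; first exact: Linfty_step.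
  exists A; split => //; first exact: Gm.
  move=> w /= nw; apply: contrapT => wA; apply: nw.
  by rewrite memNset// normr0.
Qed.

(** The sums defining the integral are the values of [L] at the step functions [S k], which converge
    to the coordinate uniformly outside null sets, and [L] is continuous for the essential sup
    norm. *)
Lemma functional_measureE X : Linf X ->
  ba_pairing (functional_measure L) X = L X.
Proof.
move=> LX; have [mX [J XJ]] := LX.
have coordE : X = \sum_i (fun w => X w 0 i *: delta_mx 0 i).
  by apply/funext => w; rewrite fct_sumE [LHS]row_sum_delta.
rewrite [in RHS]coordE Lsum; last by move=> i; exact: Linfty_coord.
apply: eq_bigr => i _; set Xi := (X in L X).
have LXi : Linf Xi by exact: Linfty_coord.
pose f w := X w 0 i.
have mf a b : F T [set w | a <= f w /\ f w < b] by exact: measurable_levels.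
have fJ : \forall w \ae P, `|f w| <= J.
  by apply: filterS XJ => w; exact: le_trans (ler_row_norm _ _).
apply: cvg_lim => //.
pose S k : Omega -> 'rV[R]_n := \sum_(j < k * k + k * k) (fa_level k j *:
  (fun w => if w \in fa_cell f k j then delta_mx 0 i else 0)).
have LS k : Linf (S k).
  by apply: Linfty_sum => j _; apply: LinftyZ; apply: Linfty_step; exact: mf.
have SE k : fa_sum (fun A => functional_measure L A 0 i) f k = L (S k).
  rewrite fa_sumE Lsum; last first.
    by move=> j; apply: LinftyZ; apply: Linfty_step; exact: mf.
  apply: eq_bigr => j _; rewrite LZ ?mxE//; apply: Linfty_step; exact: mf.
have SX k : J < k%:R -> \forall w \ae P, `|S k w - Xi w| <= k%:R^-1.
  move=> Jk; have [_ tC] := fa_cell_partition mf fJ Jk.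
  apply: filterS => w [j0 j0w].
  have -> : S k w = fa_level k j0 *: delta_mx 0 i.
    have -> : S k w = \sum_(j < k * k + k * k) fa_level k j *:
        (if w \in fa_cell f k j then delta_mx 0 i else 0) by rewrite /S fct_sumE.
    rewrite (bigD1 j0)//= big1 ?addr0; first by rewrite (mem_set j0w).
    move=> j jj0; rewrite memNset ?scaler0// => jw.
    by move/eqP: jj0; apply; apply: tC => //; exists w.
  rewrite -scalerBl normrZ -[X in _ <= X]mulr1.
  apply: ler_pM => //; last exact: norm_basis_vec.
  move: j0w; rewrite /fa_cell /= fa_levelS -[X w 0 i]/(f w) => -[lo hi].
  by rewrite ler_norml; apply/andP; split; lra.
apply/cvgrPdist_le => e e0.
have K1 : 0 < `|K| + 1 by rewrite ltr_wpDl.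
near=> k; rewrite distrC SE -LB//.
have k0 : 0 < k%:R :> R by rewrite ltr0n; near: k; exists 1%N.
apply: (@le_trans _ _ (K * k%:R^-1)).
  apply: Labs; [exact: LinftyB|by rewrite invr_ge0|apply: SX].
  by near: k; exact: nbhs_infty_gtr.
rewrite ler_pdivrMr//.
have ke : (`|K| + 1) / e <= k%:R by near: k; exact: nbhs_infty_ger.
move: ke; rewrite ler_pdivrMr// mulrC; have := ler_norm K; lra.
Unshelve. all: by end_near. Qed.

End Representation.
End BoundedClaimsDual.

(** * Expectation *)

(** Moving negative parts across leaves only nonnegative terms, so the concavity inequality can be
    integrated without meeting [+oo - +oo]. The second inequality makes the negative part of the
    combination integrable. *)
Lemma concave_funepos_funeneg {R : realDomainType} (t : R) (x y z : \bar R) :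
  0 < t -> t < 1 -> (x < +oo)%E -> (y < +oo)%E -> (z < +oo)%E ->
  (t%:E * x + (1 - t)%:E * y <= z)%E ->
  (t%:E * maxe x 0 + (1 - t)%:E * maxe y 0 + maxe (- z) 0 <=
    maxe z 0 + (t%:E * maxe (- x) 0 + (1 - t)%:E * maxe (- y) 0))%E /\
  (maxe (- z) 0 <= t%:E * maxe (- x) 0 + (1 - t)%:E * maxe (- y) 0)%E.
Proof.
move=> t0 t1 xoo yoo zoo; have t1' : 0 < 1 - t by rewrite subr_gt0.
have max0 u : (0 <= maxe u 0 :> \bar R)%E by rewrite le_max lexx orbT.
have tmax0 k u : 0 < k -> (0 <= k%:E * maxe u 0 :> \bar R)%E.
  by move=> k0; rewrite mule_ge0// lee_fin ltW.
have addoo (u : \bar R) : (0 <= u -> u + +oo = +oo)%E by case: u.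
case: x xoo => [x _|//|_]; last first.
  move=> _; have -> : (maxe (- -oo) 0 = +oo :> \bar R)%E by rewrite maxye.
  by rewrite (gt0_muley (x := t%:E)) ?lte_fin// (addeC +oo%E) !addoo ?leey ?tmax0.
case: y yoo => [y _|//|_]; last first.
  move=> _; have -> : (maxe (- -oo) 0 = +oo :> \bar R)%E by rewrite maxye.
  by rewrite (gt0_muley (x := (1 - t)%:E)) ?lte_fin// !addoo ?leey ?tmax0.
case: z zoo => [z _|//|//].
rewrite -!EFinN -!EFin_max -!EFinM -!EFinD !lee_fin => xyz.
have maxN (u : R) : Num.max (- u) 0 = Num.max u 0 - u.
  by rewrite !maxEle oppr_le0; case: leP => u0; case: leP => u1; lra.
have maxge (u : R) : 0 <= Num.max u 0 /\ u <= Num.max u 0.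
  by rewrite !le_max !lexx orbT.
rewrite !maxN; split; first by lra.
have [x1 x2] := maxge x; have [y1 y2] := maxge y.
have tx : 0 <= t * (Num.max x 0 - x) by rewrite mulr_ge0 ?subr_ge0// ltW.
have ty : 0 <= (1 - t) * (Num.max y 0 - y) by rewrite mulr_ge0 ?subr_ge0// ltW.
have tx' : 0 <= t * Num.max x 0 by rewrite mulr_ge0// ltW.
have ty' : 0 <= (1 - t) * Num.max y 0 by rewrite mulr_ge0// ltW.
by case: (leP z 0) => z0; lra.
Qed.

Section Expectation.
Context {R : realType} {dsp : measure_display} {Omega : measurableType dsp}.
Context {P : probability Omega R}.
Local Open Scope ereal_scope.
Implicit Types (f g h : Omega -> \bar R) (a b C t : R).

Lemma integral_prob_cst (c : \bar R) : \int[P]_w c = c.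
Proof.
rewrite -[RHS]mule1 -(probability_setT P).
exact: (integral_cst P measurableT c).
Qed.

(** Expectations are compared through the reals below them: such a real excludes the conventional
    value [-oo], and the comparison becomes an inequality without subtraction, valid also when the
    positive part has infinite integral. *)
Lemma expect_geP f a : a%:E <= expect P f <->
  (\int[P]_w f^\- w < +oo) /\ a%:E + \int[P]_w f^\- w <= \int[P]_w f^\+ w.
Proof.
rewrite /expect; case: ifPn => [/eqP ->|fn].
  by split => [|[]]; rewrite ?ltxx// leNgt ltNye.
have fn0 : 0 <= \int[P]_w f^\- w by exact: integral_ge0.
have fnoo : \int[P]_w f^\- w < +oo by rewrite lt_neqAle fn leey.
rewrite integralE; split => [h|[_ h]].
  by split => //; rewrite -leeBrDr// fin_num_abs gee0_abs.
by rewrite leeBrDr// fin_num_abs gee0_abs.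
Qed.

Lemma expect_concave f g h t a b : (0 < t)%R -> (t < 1)%R ->
  measurable_fun setT f -> measurable_fun setT g -> measurable_fun setT h ->
  (forall w, f w < +oo) -> (forall w, g w < +oo) -> (forall w, h w < +oo) ->
  (\forall w \ae P, t%:E * f w + (1 - t)%:E * g w <= h w) ->
  a%:E <= expect P f -> b%:E <= expect P g ->
  (t * a + (1 - t) * b)%:E <= expect P h.
Proof.
move=> t0 t1 mf mg mh foo goo hoo fgh /expect_geP[fn af] /expect_geP[gn bg].
have t1' : (0 < 1 - t)%R by rewrite subr_gt0.
have pw : \forall w \ae P,
    t%:E * f^\+ w + (1 - t)%:E * g^\+ w + h^\- w <=
      h^\+ w + (t%:E * f^\- w + (1 - t)%:E * g^\- w) /\
    h^\- w <= t%:E * f^\- w + (1 - t)%:E * g^\- w.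
  apply: filterS fgh => w; rewrite !funeposE !funenegE.
  exact: concave_funepos_funeneg.
have mfp := measurable_funepos mf; have mfn := measurable_funeneg mf.
have mgp := measurable_funepos mg; have mgn := measurable_funeneg mg.
have mhp := measurable_funepos mh; have mhn := measurable_funeneg mh.
have mtf (k : R) (u : Omega -> \bar R) : measurable_fun setT u ->
     measurable_fun setT (fun w => k%:E * u w).
  by move=> mu; exact: measurable_funeM.
have tge0 (k : R) (u : \bar R) : (0 < k)%R -> 0 <= u -> 0 <= k%:E * u.
  by move=> k0 u0; rewrite mule_ge0// lee_fin ltW.
have In : \int[P]_w (t%:E * f^\- w + (1 - t)%:E * g^\- w) =
    t%:E * \int[P]_w f^\- w + (1 - t)%:E * \int[P]_w g^\- w.
  rewrite ge0_integralD//; last 4 first.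
    by move=> w _; exact: tge0.
    exact: mtf.
    by move=> w _; exact: tge0.
    exact: mtf.
  by rewrite !ge0_integralZl_EFin// ltW.
have Ip : \int[P]_w (t%:E * f^\+ w + (1 - t)%:E * g^\+ w) =
    t%:E * \int[P]_w f^\+ w + (1 - t)%:E * \int[P]_w g^\+ w.
  rewrite ge0_integralD//; last 4 first.
    by move=> w _; exact: tge0.
    exact: mtf.
    by move=> w _; exact: tge0.
    exact: mtf.
  by rewrite !ge0_integralZl_EFin// ltW.
have fn0 : 0 <= \int[P]_w f^\- w by exact: integral_ge0.
have gn0 : 0 <= \int[P]_w g^\- w by exact: integral_ge0.
have hn0 : 0 <= \int[P]_w h^\- w by exact: integral_ge0.
have mcomb (u v : Omega -> \bar R) :
    measurable_fun setT u -> measurable_fun setT v ->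
    measurable_fun setT (fun w => t%:E * u w + (1 - t)%:E * v w).
  by move=> mu mv; apply: emeasurable_funD; exact: mtf.
have hn : \int[P]_w h^\- w <=
    t%:E * \int[P]_w f^\- w + (1 - t)%:E * \int[P]_w g^\- w.
  rewrite -In; apply: ae_ge0_le_integral => //.
  - by move=> w _; rewrite adde_ge0// tge0.
  - exact: mcomb.
  - by apply: filterS pw => w [].
have main : t%:E * \int[P]_w f^\+ w +
    (1 - t)%:E * \int[P]_w g^\+ w + \int[P]_w h^\- w <=
    \int[P]_w h^\+ w + (t%:E * \int[P]_w f^\- w + (1 - t)%:E * \int[P]_w g^\- w).
  rewrite -In -Ip -!ge0_integralD//.
  - apply: ae_ge0_le_integral => //.
    + by move=> w _; rewrite !adde_ge0// tge0.
    + by apply: emeasurable_funD => //; exact: mcomb.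
    + by move=> w _; rewrite !adde_ge0// tge0.
    + by apply: emeasurable_funD => //; exact: mcomb.
    + by apply: filterS pw => w [].
  - by move=> w _; rewrite !adde_ge0// tge0.
  - exact: mcomb.
  - by move=> w _; rewrite !adde_ge0// tge0.
  - exact: mcomb.
apply/expect_geP.
move: fn gn af bg hn main fn0 gn0 hn0.
have : 0 <= \int[P]_w f^\+ w by exact: integral_ge0.
have : 0 <= \int[P]_w g^\+ w by exact: integral_ge0.
have : 0 <= \int[P]_w h^\+ w by exact: integral_ge0.
case: (\int[P]_w f^\- w) (\int[P]_w g^\- w) => [A| |] [B| |]//.
case: (\int[P]_w h^\- w) => [H| |]//.
case: (\int[P]_w h^\+ w) => [H'| |]//; last by move=> *; rewrite ltry leey.
case: (\int[P]_w f^\+ w) => [A'| |]//; last first.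
  move=> _ gp _ _ _ _ _ _; rewrite gt0_muley ?lte_fin//.
  by case: (\int[P]_w g^\+ w) gp => [B'| |]// _; rewrite ?gt0_muley ?lte_fin.
case: (\int[P]_w g^\+ w) => [B'| |]//; last first.
  by move=> _ _ _ _ _ _ _ _; rewrite gt0_muley ?lte_fin.
move=> _ _ _ _ _; rewrite -!EFinM -!EFinD !lee_fin => aA bB _ main _ _ _.
split; first by rewrite ltry.
have := ler_wpM2l (ltW t0) aA; have := ler_wpM2l (ltW t1') bB.
rewrite !mulrDr; lra.
Qed.

(** This is [expect_concave] with both functions equal to [f] and weight [1 / 2]. *)
Lemma expect_le f h a : measurable_fun setT f -> measurable_fun setT h ->
  (forall w, f w < +oo) -> (forall w, h w < +oo) ->
  (\forall w \ae P, f w <= h w) -> a%:E <= expect P f -> a%:E <= expect P h.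
Proof.
move=> mf mh foo hoo fh af.
have half0 : (0 < 2^-1 :> R)%R by rewrite invr_gt0.
have half1 : (2^-1 < 1 :> R)%R by rewrite invf_lt1// ltr1n.
rewrite (_ : a = 2^-1 * a + (1 - 2^-1) * a)%R; last by field.
apply: (expect_concave half0 half1 mf mf mh) => //.
apply: filterS fh => w; have := foo w; case: (f w) => [r| |]// _ rh.
- by rewrite -!EFinM -EFinD (_ : _ + _ = r)%R//; field.
- by rewrite gt0_muleNy// leNye.
Qed.

Lemma expect_cst_ge f a : measurable_fun setT f -> (forall w, f w < +oo) ->
  (\forall w \ae P, a%:E <= f w) -> a%:E <= expect P f.
Proof.
move=> mf foo af; apply: (expect_le (f := cst a%:E)) => //.
  by move=> w; rewrite ltry.
apply/expect_geP.
under eq_integral do rewrite funenegE /=.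
under [X in _ <= X]eq_integral do rewrite funeposE /=.
rewrite !integral_prob_cst -!EFin_max ltry -EFinD lee_fin.
split => //; rewrite !maxEle; case: (leP (- a)%R 0%R) => ?;
  case: (leP a 0%R) => ?; lra.
Qed.

(** Adding the lower bound produces an integrand to which monotone convergence applies; the maximum
    with 0 makes it nonnegative everywhere and not only almost surely. *)
Lemma expect_shift f C : (0 <= C)%R -> measurable_fun setT f ->
  (forall w, f w < +oo) -> (\forall w \ae P, (- C)%:E <= f w) ->
  expect P f = \int[P]_w (maxe (f w + C%:E) 0) - C%:E.
Proof.
move=> C0 mf foo fC.
have mfC : measurable_fun setT (fun w => maxe (f w + C%:E) 0).
  apply: measurable_maxe => //; apply: emeasurable_funD => //.
have mfp := measurable_funepos mf; have mfn := measurable_funeneg mf.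
have fn0 : 0 <= \int[P]_w f^\- w by exact: integral_ge0.
have fnC : \int[P]_w f^\- w <= C%:E.
  rewrite -[X in _ <= X]integral_prob_cst.
  apply: ae_ge0_le_integral => //.
  apply: filterS fC => w; rewrite funenegE /= ge_max lee_fin C0 andbT => h _.
  by rewrite leeNl.
have eqI : \int[P]_w (maxe (f w + C%:E) 0) + \int[P]_w f^\- w =
    \int[P]_w f^\+ w + C%:E.
  rewrite -[in RHS](integral_prob_cst C%:E).
  rewrite -!ge0_integralD//; last by move=> w _; rewrite le_max lexx orbT.
  apply: ge0_ae_eq_integral => //.
  - exact: emeasurable_funD.
  - exact: emeasurable_funD.
  - by move=> w _; rewrite adde_ge0// le_max lexx orbT.
  - by move=> w _; rewrite adde_ge0.
  apply: filterS fC => w; rewrite funenegE funeposE /= => h _.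
  move: h (foo w); case: (f w) => [r| |]//; rewrite lee_fin => rC _.
  rewrite -EFinN -EFinD -!EFin_max -!EFinD; congr EFin.
  rewrite !maxEle; case: (leP (r + C)%R 0%R) => ?; case: (leP (- r)%R 0%R) => ?;
    case: (leP r 0%R) => ?; lra.
rewrite /expect ifF; last first.
  by apply/negbTE; rewrite lt_eqF// (le_lt_trans fnC) ?ltry.
rewrite integralE; move: eqI fnC fn0.
case: (\int[P]_w f^\- w) => [r| |]//.
case: (\int[P]_w maxe _ _) => [s| |]//; case: (\int[P]_w f^\+ w) => [t| |]//.
rewrite -!EFinD => -[st] _ _; congr EFin; lra.
Qed.

(** Monotone convergence after the shift by [C]. Pointwise the sequence ends by being equal to [g],
    which allows compositions with a discontinuous utility. *)
Lemma expect_eventually_le (f : nat -> Omega -> \bar R) g C K : (0 <= C)%R ->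
  (forall n, measurable_fun setT (f n)) -> measurable_fun setT g ->
  (forall n w, f n w < +oo) -> (forall w, g w < +oo) ->
  (forall w m n, (m <= n)%N -> f m w <= f n w) ->
  (forall w, exists N, forall n, (N <= n)%N -> f n w = g w) ->
  (\forall w \ae P, (- C)%:E <= f 0%N w) ->
  (forall n, expect P (f n) <= K) -> expect P g <= K.
Proof.
move=> C0 mf mg foo goo fnd fg fC fK.
have gC : \forall w \ae P, (- C)%:E <= g w.
  apply: filterS fC => w /le_trans; apply.
  by have [N fNg] := fg w; rewrite -(fNg N)// fnd.
have fnC n : \forall w \ae P, (- C)%:E <= f n w.
  by apply: filterS fC => w /le_trans; apply; exact: fnd.
rewrite (expect_shift C0)// leeBlDr//.
pose h n w := maxe (f n w + C%:E) 0.
have mh n : measurable_fun setT (h n).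
  by apply: measurable_maxe => //; exact: emeasurable_funD.
have := @cvg_monotone_convergence _ _ _ P setT measurableT h mh.
have h0 n w : setT w -> 0 <= h n w by move=> _; rewrite le_max lexx orbT.
have hnd w : setT w -> {homo h^~ w : n m / (n <= m)%N >-> n <= m}.
  move=> _ m n mn; apply: le_max2 => //; exact/leeD2r/fnd.
move=> /(_ h0 hnd) cvgh.
have limh w : limn (h^~ w) = maxe (g w + C%:E) 0.
  apply: lim_near_cst => //; have [N fNg] := fg w.
  by exists N => // n /= Nn; rewrite /h fNg.
rewrite -(eq_integral _ _ (fun w _ => limh w)) -(cvg_lim _ cvgh)//.
apply: lime_le; first by apply/cvg_ex; eexists; exact: cvgh.
apply: nearW => n; rewrite -leeBlDr//.
by have := fK n; rewrite (expect_shift C0).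
Qed.

End Expectation.

(** * Cones *)

Section Cones.
Context {R : realType} {n : nat}.
Implicit Types (x y : 'rV[R]_n) (A G : set 'rV[R]_n).

Lemma closure_normP A x :
  closure A x <-> forall e, 0 < e -> exists2 y, A y & `|x - y| < e.
Proof.
split => [cAx e e0|h B /nbhs_ballP[e /= e0 eB]].
  have [y [Ay xy]] := cAx _ (nbhsx_ballx x e e0).
  by exists y => //; rewrite -ball_normE in xy.
have [y Ay xy] := h _ e0; exists y; split => //; apply: eB.
by rewrite -ball_normE.
Qed.

Lemma closure_convex_cone A : convex_cone A -> convex_cone (closure A).
Proof.
move=> cA l m x y l0 m0 /closure_normP clx /closure_normP cly.
apply/closure_normP => e e0.
have lm : 0 < l + m + 1 by lra.
have d0 : 0 < e / (l + m + 1) by rewrite divr_gt0.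
have [x' Ax' xx'] := clx _ d0; have [y' Ay' yy'] := cly _ d0.
exists (l *: x' + m *: y'); first exact: cA.
rewrite opprD addrACA -!scalerBr (le_lt_trans (ler_normD _ _))//
  !normrZ !ger0_norm//.
apply: (@le_lt_trans _ _ ((l + m) * (e / (l + m + 1)))).
  by rewrite mulrDl lerD// ler_wpM2l// ltW.
by rewrite mulrCA gtr_pMr// ltr_pdivrMr//; lra.
Qed.

Lemma convex_setP A : convex_set (A : set (convex_lmodType 'rV[R]_n)) <->
  forall x y t, 0 <= t -> t <= 1 -> A x -> A y -> A (t *: x + (1 - t) *: y).
Proof.
split => [cA x y t t0 t1 Ax Ay|cA x y t /set_mem Ax /set_mem Ay].
  by have /set_mem := cA x y (Itv01 t0 t1) (mem_set Ax) (mem_set Ay).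
by apply/mem_set; apply: cA.
Qed.

Lemma closed_convex_hull_cone G : G 0 ->
  (forall c x, 0 < c -> G x -> G (c *: x)) -> convex_cone (closed_convex_hull G).
Proof.
move=> G0 Gc; apply: closure_convex_cone.
set H := smallest _ _.
have GH : G `<=` H by exact: sub_gen_smallest.
have cH x y t : 0 <= t -> t <= 1 -> H x -> H y -> H (t *: x + (1 - t) *: y).
  move=> t0 t1 Hx Hy A [cA GA]; move/convex_setP : (cA) => {}cA'.
  by apply: cA' => //; [exact: Hx|exact: Hy].
have Hc c x : 0 < c -> H x -> H (c *: x).
  move=> c0 Hx A [/convex_setP cA GA].
  (* The preimage under scaling by [c] of a convex set containing [G] is again convex and contains
     [G]. *)
  apply: (Hx [set y | A (c *: y)]); split; last by move=> y Gy; exact/GA/Gc.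
  apply/convex_setP => y z t t0 t1 /= Ay Az.
  by rewrite scalerDr !scalerA ![c * _]mulrC -!scalerA; exact: cA.
have Hc0 c x : 0 <= c -> H x -> H (c *: x).
  rewrite le_eqVlt => /predU1P[<- _|c0]; last exact: Hc.
  by rewrite scale0r; exact: GH.
move=> l m x y l0 m0 Hx Hy.
have [lm0|lm] := eqVneq (l + m) 0.
  move/eqP: lm0; rewrite paddr_eq0// => /andP[/eqP -> /eqP ->].
  by rewrite !scale0r addr0; exact: GH.
have lm0 : 0 < l + m by rewrite lt_neqAle eq_sym lm addr_ge0.
have -> : l *: x + m *: y =
    (l + m) *: ((l / (l + m)) *: x + (1 - l / (l + m)) *: y).
  rewrite scalerDr !scalerA; congr (_ *: _ + _ *: _); field => //.
apply: Hc => //; apply: cH => //; first by rewrite divr_ge0// ltW.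
by rewrite ler_pdivrMr// mul1r lerDl.
Qed.

Lemma sub_closed_convex_hull G : G `<=` closed_convex_hull G.
Proof. by move=> x Gx; apply: subset_closure; exact: sub_gen_smallest. Qed.

Lemma cone_hull_convex G : convex_cone (cone_hull G).
Proof.
move=> l m x y l0 m0 Hx Hy A [cA GA].
apply: (cA) => //; [exact: (Hx A (conj cA GA))|exact: (Hy A (conj cA GA))].
Qed.

Lemma dotDl x y z : dot (x + y) z = dot x z + dot y z.
Proof. by rewrite /dot -big_split; apply: eq_bigr => i _; rewrite mxE mulrDl. Qed.

Lemma dotZl c x z : dot (c *: x) z = c * dot x z.
Proof. by rewrite /dot mulr_sumr; apply: eq_bigr => i _; rewrite mxE mulrA. Qed.

Lemma dot_ge0 x z : orthant x -> orthant z -> 0 <= dot x z.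
Proof. by move=> x0 z0; apply: sumr_ge0 => i _; rewrite mulr_ge0. Qed.

Lemma orthant_const c : 0 <= c -> orthant (const_mx c : 'rV[R]_n).
Proof. by move=> c0 i; rewrite mxE. Qed.

End Cones.

Lemma solvency_coneZ {R : realType} {D : nat} (Pi : 'M[R]_D) c x : 0 <= c ->
  solvency_cone Pi x -> solvency_cone Pi (c *: x).
Proof.
move=> c0 Kx; rewrite -[_ *: _]addr0 -(scale0r x).
exact: cone_hull_convex.
Qed.

Lemma solvency_coneD {R : realType} {D : nat} (Pi : 'M[R]_D) x y :
  solvency_cone Pi x -> solvency_cone Pi y -> solvency_cone Pi (x + y).
Proof.
by move=> Kx Ky; rewrite -[x]scale1r -[y]scale1r; exact: cone_hull_convex.
Qed.

Lemma orthant_solvency {R : realType} {D : nat} (Pi : 'M[R]_D) : (0 < D)%N ->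
  @orthant R D `<=` solvency_cone Pi.
Proof.
move=> D0 x x0.
have Ke i : solvency_cone Pi (basis_vec i).
  by apply: sub_gen_smallest; left; exists i.
rewrite [x]row_sum_delta; apply: big_ind.
- by rewrite -(scale0r (basis_vec (Ordinal D0))); exact: solvency_coneZ.
- exact: solvency_coneD.
- by move=> i _; apply: solvency_coneZ; [exact: x0|exact: Ke].
Qed.

(** * Portfolios *)

Lemma bounded_variationZ {R : realType} (a b c : R) f :
  bounded_variation a b f -> bounded_variation a b (fun t => c * f t).
Proof.
move=> [K fK]; exists (`|c| * K) => _ [s abs] <-.
rewrite (_ : variation _ _ _ _ = `|c| * variation a b f s).
  by rewrite ler_wpM2l//; apply: fK; exact: variations_variation.
rewrite /variation mulr_sumr; apply: eq_bigr => i _ /=.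
by rewrite -mulrBr normrM.
Qed.


Section Market.
Context {R : realType} {dsp : measure_display} {Omega : measurableType dsp}.
Context {P : probability Omega R} {T : R} {F : R -> set_system Omega}.
Context {D : nat} {Pi : R -> Omega -> 'M[R]_D}.
Hypothesis T0 : 0 < T.
Hypothesis D0 : (0 < D)%N.
Hypothesis usual : usual_filtration P T F.
Hypothesis F_left : left_sigma_algebra F T = F T.

Let FT_sigma : sigma_algebra setT (F T).
Proof. by case: usual => /(_ T (ltW T0) (lexx T))[]. Qed.

Let Fsub s : 0 <= s -> s <= T -> F s `<=` F T.
Proof. by move=> s0 sT; case: usual => _ FF _ _; exact: FF. Qed.

(* A sigma-algebra on the whole of [R * Omega], so that the results on
   [measurable_for] apply to predictable processes. *)
Definition predictable_trace : set_system (R * Omega) :=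
  [set B | predictable_sets T F (`[0, T] `*` setT `&` B)].

Lemma predictable_trace_sigma : sigma_algebra setT predictable_trace.
Proof.
have [p0 pC pU] : sigma_algebra (`[0, T] `*` setT) (predictable_sets T F).
  exact: smallest_sigma_algebra.
split.
- by rewrite /predictable_trace /= setI0.
- move=> A; rewrite /predictable_trace /= setTD => /pC.
  by rewrite setDIr setDv set0U setDE.
- by move=> A pA; rewrite /predictable_trace /= setI_bigcupr; exact: pU.
Qed.

Lemma predictable_traceP {E : topologicalType} (V : R -> Omega -> E) :
  predictable_process T F V <->
  measurable_for predictable_trace (fun z : R * Omega => V z.1 z.2).
Proof. by []. Qed.

Lemma predictable_trace_itv s A : 0 <= s -> s < T -> F s A ->
  predictable_trace (`]s, T] `*` A).
Proof.
move=> s0 sT FA; rewrite /predictable_trace /=.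
rewrite (_ : _ `&` _ = `]s, T] `*` A).
  by apply: sub_gen_smallest; right; exists s, T, A.
apply/setIidPr => -[t w] /= [+ Aw]; rewrite in_itv/= => /andP[st tT].
by split => //=; rewrite in_itv/= tT (le_trans s0)// ltW.
Qed.

(** [{T} x Omega] is the intersection of the sets []s k, T] x Omega], where [s k] increases to [T].
    For [A] in [F s] with [s < T], [{T} x A] is its intersection with []s, T] x A], and such [A]
    generate [F T] because [F_(T-) = F_T]. *)
Lemma predictable_trace_last A : F T A -> predictable_trace ([set T] `*` A).
Proof.
have sP := predictable_trace_sigma.
have FT : predictable_trace ([set T] `*` setT).
  pose s k : R := T - T * k.+1%:R^-1.
  rewrite (_ : _ `*` _ = ~` \bigcup_k ~` (`]s k, T] `*` setT)).
    apply: (sigmaC sP); apply: (sigma_bigcup sP) => k; apply: (sigmaC sP).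
    apply: predictable_trace_itv.
    - by rewrite subr_ge0 ger_pMr// invf_le1// ler1n.
    - by rewrite gtrBl mulr_gt0.
    - apply: sigmaT; case: usual => /(_ (s k)) [] //.
      + by rewrite subr_ge0 ger_pMr// invf_le1// ler1n.
      + by rewrite gerBl mulr_ge0// ltW.
  rewrite setC_bigcup; under eq_bigcapr do rewrite setCK.
  apply/seteqP; split => -[t w] /=.
    move=> [-> _] k _ /=; split => //=.
    by rewrite in_itv/= lexx andbT gtrBl mulr_gt0.
  move=> h; split => //; apply/eqP; rewrite eq_le; apply/andP; split.
    by have [] := h 0%N Logic.I; rewrite /= in_itv /= => /andP[].
  apply/ler_addgt0Pr => e e0.
  have [k ke] := @natSinv_lt R (e / T) ltac:(by rewrite divr_gt0).
  have [] := h k Logic.I; rewrite /= in_itv/= => /andP[+ _] _.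
  move: ke; rewrite ltr_pdivlMr// mulrC /s; move: (T / _) => q qe tq.
  by rewrite -lerBlDr ltW// (lt_trans _ tq)// ltrD2l ltrN2.
rewrite -F_left => FTA.
apply: (FTA [set A | predictable_trace ([set T] `*` A)]); split => /=.
  split => /=.
  - by rewrite setX0; case: sP.
  - move=> B pB; rewrite setTD.
    rewrite (_ : _ `*` _ = ([set T] `*` setT) `&` ~` ([set T] `*` B)).
      by apply: (sigmaI sP) => //; exact: (sigmaC sP).
    apply/seteqP; split => -[t w] /=; first by move=> [-> nB]; split => // -[].
    by move=> [[-> _] nB]; split => // Bw; apply: nB.
  - move=> B pB; rewrite setX_bigcupr.
    exact: (sigma_bigcup sP).
move=> B [s [s0 sT] FB] /=.
rewrite (_ : _ `*` _ = ([set T] `*` setT) `&` (`]s, T] `*` B)).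
  by apply: (sigmaI sP) => //; exact: predictable_trace_itv.
apply/seteqP; split => -[t w] /=; last by move=> [[-> _] [_ ?]].
by move=> [-> Bw]; rewrite in_itv /= sT lexx.
Qed.

Lemma predictable_section (V : R -> Omega -> 'rV[R]_D) :
  predictable_process T F V -> measurable_for (F T) (V T).
Proof.
move=> pV B /pV.
set C := (X in predictable_sets _ _ X).
have -> : V T @^-1` B = [set w | C (T, w)].
  apply/seteqP; split => w /=; last by case.
  by move=> VB; rewrite /C /= in_itv /= lexx ltW.
(* The sections at [T] of all predictable sets lie in [F T], which is checked on generators; those
   at time 0 have an empty section because [T > 0]. *)
apply: (@smallest_sub _ _ _ [set C | F T [set w | C (T, w)]]).
  split => /=.
  - by case: FT_sigma.
  - move=> A FA; rewrite (_ : [set w | _] = ~` [set w | A (T, w)]).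
      exact: (sigmaC FT_sigma).
    apply/seteqP; split => w /=; first by case.
    by move=> nA; split => //=; rewrite in_itv/= lexx ltW.
  - move=> A FA; rewrite (_ : [set w | _] = \bigcup_k [set w | A k (T, w)]).
      exact: (sigma_bigcup FT_sigma).
    by apply/seteqP; split => w [k _ Ak]; exists k.
move=> A [[B0 FB <-]|[s [t [B0 [s0 st tT FB ->]]]]] /=.
  rewrite (_ : [set w | _] = set0); first by case: FT_sigma.
  by apply/seteqP; split => // w [/= Tz _]; move: T0; rewrite Tz ltxx.
have [tE|tT'] := eqVneq t T.
  rewrite (_ : [set w | _] = B0).
    by apply: Fsub FB => //; rewrite (le_trans (ltW st)).
  apply/seteqP; split => w /=; first by case.
  by move=> Bw; split => //; rewrite in_itv/= tE lexx -tE st.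
rewrite (_ : [set w | _] = set0); first by case: FT_sigma.
apply/seteqP; split => // w [/=]; rewrite in_itv/= => /andP[_ Tt] _.
by move: tT'; rewrite eq_le tT Tt.
Qed.

Lemma predictable_lin (a b : R) (V W : R -> Omega -> 'rV[R]_D) :
  predictable_process T F V -> predictable_process T F W ->
  predictable_process T F (fun t w => a *: V t w + b *: W t w).
Proof.
move=> /predictable_traceP pV /predictable_traceP pW; apply/predictable_traceP.
exact: (measurable_for_lin predictable_trace_sigma).
Qed.

Lemma predictable_set_last (V : R -> Omega -> 'rV[R]_D) Y :
  predictable_process T F V -> measurable_for (F T) Y ->
  predictable_process T F (fun t w => if t == T then Y w else V t w).
Proof.
move=> /predictable_traceP pV mY; apply/predictable_traceP.
have sP := predictable_trace_sigma.
apply: (measurable_for_opens sP) => C oC.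
rewrite (_ : _ @^-1` _ = ([set T] `*` (Y @^-1` C)) `|`
    (~` ([set T] `*` setT) `&` (fun z : R * Omega => V z.1 z.2) @^-1` C)).
  apply: (sigmaU sP).
    by apply: predictable_trace_last; exact: measurable_for_open.
  apply: (sigmaI sP); last exact: measurable_for_open.
  by apply: (sigmaC sP); apply: predictable_trace_last; exact: (sigmaT FT_sigma).
apply/seteqP; split => -[t w] /=.
  by case: eqP => [->|tT]; [left|right; split => // -[]].
by move=> [[-> ?]|[tT ?]]; [rewrite eqxx|case: eqP => // ?; exfalso; exact: tT].
Qed.

Definition trading_hull (sigma tau : Omega -> \bar R) (w : Omega) :=
  closed_convex_hull
    (\bigcup_(t in [set t : R | (sigma w <= t%:E)%E /\ (t%:E < tau w)%E])
       solvency_cone (Pi t w) `|` [set 0]).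

Lemma trading_hull_cone sigma tau w : convex_cone (trading_hull sigma tau w).
Proof.
apply: closed_convex_hull_cone; first by right.
move=> c x c0 [[t ts Kx]|->]; last by right; rewrite scaler0.
by left; exists t => //; apply: solvency_coneZ => //; exact: ltW.
Qed.

Lemma trading_hull0 sigma tau w : trading_hull sigma tau w 0.
Proof. by apply: sub_closed_convex_hull; right. Qed.

Lemma finite_stopping_timeE tau w : finite_stopping_time T F tau ->
  exists2 t, 0 <= t <= T & tau w = t%:E.
Proof.
move=> [[/(_ w) + _] /(_ w)]; case: (tau w) => [t| |]//.
- by move=> [//|[t0 tT]] _; exists t => //; rewrite -!lee_fin t0.
- by move=> [//|[]].
Qed.

Lemma strictly_consistent_orthant Z t w : strictly_consistent P T F Pi Z ->
  0 <= t <= T -> orthant (Z t w).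
Proof. by move=> [[_ _ ZO _] _ _] /andP[t0 tT]; case: (ZO t w t0 tT). Qed.

Lemma self_financing_lin (l m : R) V W : 0 <= l -> 0 <= m ->
  self_financing P T F Pi V -> self_financing P T F Pi W ->
  self_financing P T F Pi (fun t w => l *: V t w + m *: W t w).
Proof.
move=> l0 m0 [pV bV hV] [pW bW hW]; split; first exact: predictable_lin.
  apply: filterS2 bV bW => w bV bW i.
  rewrite (_ : (fun t => _) =
    (fun t => l * V t w 0 i) \+ (fun t => m * W t w 0 i)); last first.
    by apply/funext => t; rewrite !mxE.
  by apply: bounded_variationD => //; exact: bounded_variationZ.
move=> sigma tau fs ft st.
apply: filterS2 (hV _ _ fs ft st) (hW _ _ fs ft st) => w hVw hWw.
rewrite -/(trading_hull sigma tau w) /at_time.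
have -> : - (l *: V (fine (tau w)) w + m *: W (fine (tau w)) w -
    (l *: V (fine (sigma w)) w + m *: W (fine (sigma w)) w)) =
  l *: - (V (fine (tau w)) w - V (fine (sigma w)) w) +
  m *: - (W (fine (tau w)) w - W (fine (sigma w)) w).
  by apply/rowP => i; rewrite !mxE; ring.
exact: trading_hull_cone.
Qed.

Lemma admissible_lin (l m : R) V W : 0 <= l -> 0 <= m ->
  admissible P T F Pi V -> admissible P T F Pi W ->
  admissible P T F Pi (fun t w => l *: V t w + m *: W t w).
Proof.
move=> l0 m0 [a [a0 KV ZV]] [b [b0 KW ZW]].
have eqc x y : l *: x + m *: y + const_mx (l * a + m * b + 1) =
    l *: (x + const_mx a) + m *: (y + const_mx b) + const_mx 1 :> 'rV[R]_D.
  by apply/rowP => i; rewrite !mxE; ring.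
(* The added 1 keeps the bound positive when [l] and [m] both vanish. *)
exists (l * a + m * b + 1); split.
- by rewrite ltr_wpDl// addr_ge0// mulr_ge0// ltW.
- apply: filterS2 KV KW => w KV KW; rewrite eqc.
  apply: solvency_coneD; first exact: cone_hull_convex.
  by apply: orthant_solvency => //; exact: orthant_const.
- move=> tau Z ft ZZ; apply: filterS2 (ZV _ _ ft ZZ) (ZW _ _ ft ZZ) => w ZVw ZWw.
  rewrite /at_time eqc dotDl dotDl !dotZl; apply: addr_ge0.
    by apply: addr_ge0; exact: mulr_ge0.
  have [t tT tE] := finite_stopping_timeE w ft.
  apply: dot_ge0; first exact: orthant_const.
  by rewrite tE; exact: strictly_consistent_orthant.
Qed.

Lemma terminal_lin (l m : R) x y X Y : 0 <= l -> 0 <= m ->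
  terminal P T F Pi x X -> terminal P T F Pi y Y ->
  terminal P T F Pi (l *: x + m *: y) (l *: X + m *: Y).
Proof.
move=> l0 m0 [V [sV aV V0] <-] [W [sW aW W0] <-].
exists (fun t w => l *: V t w + m *: W t w); last exact/funext.
split.
- exact: self_financing_lin.
- exact: admissible_lin.
- by apply: filterS2 V0 W0 => w -> ->.
Qed.

Lemma orthant_shift (x : 'rV[R]_D) : orthant (x + const_mx `|x|).
Proof.
move=> i; rewrite !mxE -lerBlDr sub0r lerNl (le_trans _ (ler_row_norm x i))//.
by rewrite ler_normr lexx orbT.
Qed.

Lemma terminal_cst x : terminal P T F Pi x (cst x).
Proof.
exists (fun=> cst x); last by [].
split; last exact/nearW.
  split.
  - apply/predictable_traceP.
    exact: (measurable_for_cst predictable_trace_sigma).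
  - apply/nearW => w i; apply: nondecreasing_bounded_variation => //.
  - move=> sigma tau _ _ _; apply/nearW => w.
    by rewrite subrr oppr0; exact: trading_hull0.
have xO : orthant (x + const_mx (`|x| + 1)).
  by move=> i; have := orthant_shift x i; rewrite !mxE => h; lra.
exists (`|x| + 1); split; first by rewrite ltr_wpDl.
- by apply/nearW => w; exact: orthant_solvency.
- move=> tau Z ft ZZ; apply/nearW => w; apply: dot_ge0 => //.
  have [t tT tE] := finite_stopping_timeE w ft.
  by rewrite /at_time tE; exact: strictly_consistent_orthant.
Qed.

Lemma terminal_measurable x X : terminal P T F Pi x X -> measurable_for (F T) X.
Proof. by move=> [V [[pV _ _] _ _] <-]; exact: predictable_section. Qed.

(* Goods may be thrown away at the final time: this needs [F_(T-) = F_T] for the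
   modified portfolio to be predictable. *)
Lemma terminal_below x X (Y : Omega -> 'rV[R]_D) (b : R) :
  terminal P T F Pi x X ->
  measurable_for (F T) Y -> (\forall w \ae P, orthant (X w - Y w)) ->
  (\forall w \ae P, orthant (Y w + const_mx b)) -> terminal P T F Pi x Y.
Proof.
move=> [V [[pV bV hV] [a [a0 KV ZV]] V0] <-] mY YX Yb.
pose W t w := if t == T then Y w else V t w.
exists W; last by rewrite /W eqxx.
split; last by apply: filterS V0 => w; rewrite /W lt_eqF.
  split; first exact: predictable_set_last.
    apply: filterS bV => w bV i.
    rewrite (_ : (fun t => _) = (fun t => V t w 0 i) \+
      (fun t => (Y w 0 i - V T w 0 i) * (t == T)%:R)); last first.
      apply/funext => t; rewrite /W /=; case: eqP => [->|_].
        by rewrite mulr1 addrC subrK.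
      by rewrite mulr0 addr0.
    apply: bounded_variationD => //; apply: bounded_variationZ.
    apply: nondecreasing_bounded_variation => s t.
    rewrite !in_itv/= => /andP[s0 sT] /andP[t0 tT] st.
    case: (eqVneq s T) => [sE|_]; last by case: eqP.
    by rewrite (_ : t == T)// eq_le tT -sE.
  move=> sigma tau fs ft st; apply: filterS2 YX (hV _ _ fs ft st) => w YXw.
  rewrite -/(trading_hull sigma tau w) /at_time.
  have [s /andP[s0 sT] sE] := finite_stopping_timeE w fs.
  have [t /andP[t0 tT] tE] := finite_stopping_timeE w ft.
  have := st w; rewrite sE tE /= lee_fin => st'.
  rewrite /W; have [tT'|tT'] := eqVneq t T; last first.
    case: (eqVneq s T) => // sT'.
    by move: tT'; rewrite eq_le tT -sT' st'.
  have [sT'|sT'] := eqVneq s T.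
    by rewrite subrr oppr0 => _; exact: trading_hull0.
  move=> h.
  have -> : - (Y w - V s w) = 1 *: - (V t w - V s w) + 1 *: (V t w - Y w).
    by apply/rowP => i; rewrite !mxE; ring.
  apply: trading_hull_cone => //.
  (* The goods thrown away form a nonnegative vector, hence an element of the solvency cone at [s],
     which is one of the trading times because [s < t]. *)
  apply: sub_closed_convex_hull; left; exists s.
    by rewrite /= sE tE lexx lte_fin tT' lt_neqAle sT' sT.
  by apply: orthant_solvency => //; rewrite tT'.
have bO : orthant (const_mx (a + `|b| - b) : 'rV[R]_D).
  by apply: orthant_const; have := ler_norm b; lra.
(* [a] serves the times before [T], where [W] is [V], and [b] serves the time [T]; the absolute
   value allows a negative [b]. *)
exists (a + `|b|); split; first by rewrite ltr_pwDl.
- apply: filterS Yb => w Yb; apply: orthant_solvency => // i.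
  rewrite /W eqxx; have := Yb i; have := bO i; rewrite !mxE; lra.
- move=> tau Z ft ZZ; apply: filterS2 Yb (ZV _ _ ft ZZ) => w Yb.
  have [t tT tE] := finite_stopping_timeE w ft.
  have ZO := strictly_consistent_orthant w ZZ tT.
  rewrite /at_time tE /= /W; case: eqP => [tT'|_] h.
    apply: dot_ge0 => // i; have := Yb i; have := bO i; rewrite !mxE; lra.
  rewrite (_ : _ + _ = V t w + const_mx a + const_mx `|b|).
    by rewrite dotDl addr_ge0// dot_ge0//; exact: orthant_const.
  by apply/rowP => i; rewrite !mxE; ring.
Qed.

End Market.

(** * Utility and value function *)

Lemma lee_realP {R : realType} (p q : \bar R) :
  (forall v : R, (v%:E <= p)%E -> (v%:E <= q)%E) -> (p <= q)%E.
Proof.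
case: p => [r| |] h; [exact: h| |by rewrite leNye].
case: q h => [s| |] h; [|by []|].
- by have := h (s + 1)%R (leey _); rewrite lee_fin gerDl ler10.
- by have := h 0%R (leey _).
Qed.

Section Utility.
Context {R : realType} {d D : nat} {leD : (d <= D)%N} {U : 'rV[R]_d -> \bar R}.
Hypothesis U_utility : supported_on U (@orthant R d).
Local Notation tU := (extension leD U).

Lemma extension_lt_pinfty x : (tU x < +oo)%E.
Proof.
rewrite /extension; case: asboolP => _; last by [].
by case: U_utility => -[[_ _]].
Qed.

Lemma extension_mono x y : orthant (y - x) -> (tU x <= tU y)%E.
Proof.
move=> yx; rewrite /extension; case: asboolP => x0; last by rewrite leNye.
rewrite asboolT; last by move=> i; have := yx i; have := x0 i; rewrite !mxE; lra.
case: U_utility => -[_ _ _ _ +] E; rewrite E; apply.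
by move=> i; have := yx (widen_ord leD i); rewrite !mxE.
Qed.

Lemma extension_orthant x : (-oo < tU x)%E -> orthant x.
Proof. by rewrite /extension; case: asboolP. Qed.

Lemma extension_concave x y (t : R) : 0 < t -> t < 1 ->
  (t%:E * tU x + (1 - t)%:E * tU y <= tU (t *: x + (1 - t) *: y))%E.
Proof.
move=> t0 t1; have t1' : 0 < 1 - t by lra.
rewrite {1 2}/extension; case: asboolP => x0; last first.
  by rewrite gt0_muleNy ?lte_fin// addNye leNye.
case: asboolP => y0; last first.
  by rewrite gt0_muleNy ?lte_fin// addeNy leNye.
rewrite /extension asboolT; last first.
  by move=> i; rewrite !mxE addr_ge0// mulr_ge0// ltW.
case: U_utility => -[[Uc _ _] _ _ _ _] _.
apply: (le_trans (Uc _ _ _ t0 t1)).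
have -> : \row_i (t *: x + (1 - t) *: y) 0 (widen_ord leD i) =
  t *: \row_i x 0 (widen_ord leD i) + (1 - t) *: \row_i y 0 (widen_ord leD i);
  last by [].
by apply/rowP => i; rewrite !mxE.
Qed.

(** The domain of [U] is only known to be dense in the orthant, but it has a point so close to
    [(c / 2) 1] that it lies below [c 1], and [U] is increasing. *)
Lemma extension_const_fin (c : R) : 0 < c ->
  exists v : R, tU (const_mx c) = v%:E.
Proof.
move=> c0; suff : (-oo < tU (const_mx c))%E.
  by have := extension_lt_pinfty (const_mx c); case: (tU _) => // v; exists v.
rewrite /extension asboolT; last by move=> i; rewrite mxE ltW.
rewrite (_ : \row_i _ = const_mx c); last by apply/rowP => i; rewrite !mxE.
case: U_utility => -[_ _ OU _ Umono] E.
have : closure (dom U) (const_mx (c / 2)).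
  by rewrite E; apply: orthant_const; rewrite divr_ge0// ltW.
move=> /closure_normP/(_ (c / 2) ltac:(by rewrite divr_gt0))[y Uy yc].
apply: (lt_le_trans Uy); apply: Umono; rewrite E => i.
have := ler_row_norm (const_mx (c / 2) - y) i; rewrite !mxE => h.
have := le_lt_trans h yc; rewrite ltr_norml => /andP[? ?]; lra.
Qed.

Lemma measurable_extension {dsp : measure_display} {Omega : measurableType dsp}
    {G : set_system Omega} (X : Omega -> 'rV[R]_D) :
  sigma_algebra setT G -> G `<=` measurable -> measurable_for borel U ->
  measurable_for G X -> measurable_fun setT (fun w => tU (X w)).
Proof.
move=> sG Gm mU mX.
apply: (measurability _ (ErealGenOInfty.measurableE R)) => _ [_ [a ->] <-].
rewrite setTI; apply: Gm.
pose p w : 'rV[R]_d := \row_i X w 0 (widen_ord leD i).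
have mp : measurable_for G p.
  apply/(measurable_for_rowP sG) => i; under eq_fun do rewrite mxE.
  exact: (measurable_for_rowP sG X).1.
rewrite (_ : _ @^-1` _ = (\bigcap_(i in [set: 'I_D]) [set w | 0 <= X w 0 i]) `&`
    (p @^-1` (U @^-1` `]a%:E, +oo[))).
  apply: (sigmaI sG).
    rewrite -(measurable_g_measurableTypeE sG).
    apply: fin_bigcap_measurable => // i _.
    rewrite measurable_g_measurableTypeE//.
    rewrite (_ : [set w | _] = ~` ((fun w => X w 0 i) @^-1` `]-oo, 0[)).
      apply: (sigmaC sG); apply: measurable_for_open; last exact: lray_open.
      exact: (measurable_for_rowP sG X).1.
    by apply/seteqP; split => w /=; rewrite in_itv/= leNgt => /negP.
  apply: mp; exact: (measurable_for_open mU (@rray_open _ (\bar R) a%:E)).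
apply/seteqP; split => w /=; rewrite !in_itv/= !andbT.
  move=> aX; have X0 : orthant (X w).
    by apply: extension_orthant; apply: lt_trans aX; exact: ltNyr.
  by split => [i _|]; [exact: X0|move: aX; rewrite /extension asboolT].
by move=> [X0 aX]; rewrite /extension asboolT// => i; exact: X0.
Qed.

End Utility.

(** * Value function and bounded claims *)

Section ValueFunction.
Context {R : realType} {dsp : measure_display} {Omega : measurableType dsp}.
Context {P : probability Omega R} {T : R} {F : R -> set_system Omega}.
Context {d D : nat} {leD : (d <= D)%N} {Pi : R -> Omega -> 'M[R]_D}.
Context {U : 'rV[R]_d -> \bar R}.
Hypothesis T0 : 0 < T.
Hypothesis usual : usual_filtration P T F.
Hypothesis F_left : left_sigma_algebra F T = F T.
Hypothesis d0 : (0 < d)%N.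
Hypothesis U_borel : measurable_for borel U.
Hypothesis U_utility : supported_on U (@orthant R d).

Local Notation tU := (extension leD U).
Local Notation Linf := (Linfty P T F D).
Local Notation claims := (bounded_claims P T F Pi).
Local Notation u := (value_function P T F Pi leD U).
Local Notation primal := (primal P leD U).
Local Notation one c := (const_mx c : 'rV[R]_D).

Let D0 : (0 < D)%N. Proof. exact: leq_trans leD. Qed.

Let sG : sigma_algebra setT (F T).
Proof. by case: usual => /(_ T (ltW T0) (lexx T))[]. Qed.

Let Gm : F T `<=` measurable.
Proof. by case: usual => /(_ T (ltW T0) (lexx T))[]. Qed.

Let mU (X : Omega -> 'rV[R]_D) :
  measurable_for (F T) X -> measurable_fun setT (fun w => tU (X w)).
Proof. exact: measurable_extension. Qed.

Let tU_lt x : (tU x < +oo)%E.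
Proof. exact: extension_lt_pinfty. Qed.

Lemma Linfty_orthant (X : Omega -> 'rV[R]_D) (c : R) :
  (\forall w \ae P, `|X w| <= c) -> \forall w \ae P, orthant (X w + one c).
Proof.
apply: filterS => w Xc i; rewrite !mxE.
have := le_trans (ler_row_norm (X w) i) Xc.
by rewrite ler_norml => /andP[? _]; lra.
Qed.

Lemma claims_below X (Y : Omega -> 'rV[R]_D) : terminal P T F Pi 0 X -> Linf Y ->
  (\forall w \ae P, orthant (X w - Y w)) -> claims Y.
Proof.
move=> tX LY XY; split => //; have [mY [K YK]] := LY.
apply: (terminal_below (b := K) T0 D0 usual F_left tX) => //; exact: Linfty_orthant.
Qed.

Lemma claims_nonpos (Y : Omega -> 'rV[R]_D) : Linf Y ->
  (\forall w \ae P, orthant (- Y w)) -> claims Y.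
Proof.
move=> LY Y0; apply: (claims_below (terminal_cst D0 0)) => //.
by apply: filterS Y0 => w; rewrite sub0r.
Qed.

Lemma claims_lin (l m : R) X Y : 0 <= l -> 0 <= m -> claims X -> claims Y ->
  claims (l *: X + m *: Y).
Proof.
move=> l0 m0 [tX LX] [tY LY]; split; last exact: Linfty_lin.
have := terminal_lin T0 D0 l0 m0 tX tY; by rewrite !scaler0 addr0.
Qed.

Lemma claims0 : claims 0.
Proof.
apply: claims_nonpos; first exact: (Linfty_cst sG).
by apply/nearW => w i; rewrite !mxE oppr0.
Qed.

Lemma claimsZ (l : R) X : 0 <= l -> claims X -> claims (l *: X).
Proof.
move=> l0 cX; rewrite -[_ *: _]addr0 -(scale0r 0).
by apply: claims_lin => //; exact: claims0.
Qed.

Lemma primal_concave x y (X Y : Omega -> 'rV[R]_D) (t a b : R) : 0 < t -> t < 1 ->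
  measurable_for (F T) X -> measurable_for (F T) Y ->
  (a%:E <= primal x X)%E -> (b%:E <= primal y Y)%E ->
  ((t * a + (1 - t) * b)%R%:E <=
    primal (t *: x + (1 - t) *: y)%R (t *: X + (1 - t) *: Y)%R)%E.
Proof.
move=> t0 t1 mX mY.
have mD (z : 'rV[R]_D) (Z : Omega -> 'rV[R]_D) :
    measurable_for (F T) Z -> measurable_for (F T) (fun w => z + Z w).
  move=> mZ; apply: (measurable_for_D sG) => //; exact: (measurable_for_cst sG).
apply: (expect_concave t0 t1); rewrite //; try (apply: mU; apply: mD => //).
  exact: (measurable_for_lin sG).
apply/nearW => w.
rewrite (_ : _ + (t *: X + (1 - t) *: Y) w =
  t *: (x + X w) + (1 - t) *: (y + Y w)).
  exact: extension_concave.
by rewrite !scalerDr addrACA.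
Qed.

Lemma primal_ge x (X : Omega -> 'rV[R]_D) (a c : R) : measurable_for (F T) X ->
  (a%:E <= tU (one c))%E -> (\forall w \ae P, orthant (x + X w - one c)) ->
  (a%:E <= primal x X)%E.
Proof.
move=> mX ac Xc; apply: expect_cst_ge => //.
  by apply: mU; apply: (measurable_for_D sG) => //; exact: (measurable_for_cst sG).
apply: filterS Xc => w /(extension_mono (leD := leD) U_utility).
exact: le_trans.
Qed.

(** A real lower bound makes the negative part integrable, hence finite almost surely, whereas the
    extension is [-oo] off the orthant. *)
Lemma expect_extension_orthant (X : Omega -> 'rV[R]_D) (a : R) :
  measurable_for (F T) X -> (a%:E <= expect P (fun w => tU (X w)))%E ->
  \forall w \ae P, orthant (X w).
Proof.
move=> mX /expect_geP[fn _].
have mf := mU mX.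
have : P.-integrable setT (fun w => tU (X w))^\-%E.
  apply/integrableP; split; first exact: measurable_funeneg.
  by under eq_integral do rewrite gee0_abs//.
move=> /(integrable_ae measurableT); apply: filterS => w /(_ Logic.I).
rewrite funenegE => fin; apply: (extension_orthant (leD := leD) (U := U)).
rewrite ltNye; apply: contraTneq fin => ->.
by rewrite (_ : (- -oo)%E = +oo%E :> \bar R)// maxye.
Qed.

(* The truncations of [X + e 1] at level [e + n] give bounded claims with
   utility bounded from below, and they agree with [X + e 1] for large [n]. *)
Lemma expect_le_claims x X (e : R) K : terminal P T F Pi x X -> 0 < e ->
  (forall Y, claims Y -> primal (x + one e)%R Y <= K)%E ->
  (expect P (fun w => tU (X w)) <= K)%E.
Proof.
move=> tX e0 CK.
have mX := terminal_measurable T0 usual tX.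
apply: lee_realP => a aX.
have X0 := expect_extension_orthant mX aX.
(* Since [X] is nonnegative, the level [n + e] keeps even [Z 0] above [e 1], where the utility is
   finite; this is the uniform lower bound for monotone convergence. *)
pose Z (n : nat) w : 'rV[R]_D :=
  map_mx (fun r => Num.min r (n%:R + e)) (X w + one e).
have mXe : measurable_for (F T) (fun w => X w + one e).
  by apply: (measurable_for_D sG) => //; exact: (measurable_for_cst sG).
have mZ n : measurable_for (F T) (Z n) by exact: (measurable_for_min sG).
have ne n : 0 <= n%:R :> R by [].
have [c ce] := @extension_const_fin _ _ _ leD _ U_utility e e0.
have Kge : (expect P (fun w => tU (X w + one e)%R) <= K)%E.
  apply: (@expect_eventually_le _ _ _ _ (fun n w => tU (Z n w)) _ `|c|) => //.
  - by move=> n; exact: mU.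
  - exact: mU.
  - move=> w m n mn; apply: extension_mono => // i; rewrite !mxE subr_ge0.
    by apply: le_min2 => //; rewrite lerD2r ler_nat.
  - move=> w; exists (Num.truncn `|X w|).+1 => n Nn; congr tU.
    apply/rowP => i; rewrite !mxE; apply/min_idPl; rewrite lerD2r.
    apply: (le_trans (ler_norm _)); apply: (le_trans (ler_row_norm _ _)).
    by rewrite (le_trans (ltW (truncnS_gt _)))// ler_nat.
  - apply: filterS X0 => w X0; apply: (@le_trans _ _ (tU (one e))).
      by rewrite ce lee_fin lerNl -normrN ler_norm.
    apply: extension_mono => // i; rewrite !mxE subr_ge0 le_min add0r lexx andbT.
    by rewrite lerDr.
  - move=> n.
    pose Y w := Z n w - (x + one e).
    rewrite (_ : expect _ _ = primal (x + one e) Y); last first.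
      by congr (expect P _); apply/funext => w; rewrite /Y addrC subrK.
    apply: CK; apply: (claims_below (X := X - cst x)).
    + have := terminal_lin T0 D0 ler01 ler01 tX (terminal_cst D0 (- x)).
      by rewrite !scale1r subrr.
    + split.
        by apply: (measurable_for_D sG) => //; exact: (measurable_for_cst sG).
      exists (n%:R + e + `|x + one e|); apply: filterS X0 => w X0.
      rewrite /Y (le_trans (ler_normB _ _))// lerD2r.
      have ne0 : 0 <= n%:R + e by rewrite addr_ge0// ltW.
      apply/row_norm_leP => // i; rewrite !mxE ger0_norm ?ge_min ?lexx ?orbT//.
      by rewrite le_min ne0 andbT addr_ge0// ltW.
    + apply/nearW => w i; rewrite !mxE /=.
      have : Num.min (X w 0 i + e) (n%:R + e) <= X w 0 i + e.
        by rewrite ge_min lexx.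
      lra.
apply: le_trans Kge.
apply: (expect_le (f := fun w => tU (X w))) => //; [exact: mU|exact: mU|].
apply/nearW => w; apply: extension_mono => // i; rewrite !mxE addrAC subrr add0r.
exact: ltW.
Qed.

Local Notation sup_primal x := (ereal_sup [set primal x X | X in claims]).

Lemma norm_const_mx (c : R) : 0 <= c -> `|one c| <= c.
Proof. by move=> c0; apply/row_norm_leP => // i; rewrite mxE ger0_norm. Qed.

Lemma interior_normP (A : set 'rV[R]_D) x :
  A° x <-> exists2 e, 0 < e & forall y, `|x - y| < e -> A y.
Proof.
split => [/nbhs_ballP[e /= e0 eA]|[e e0 eA]].
  by exists e => // y xy; apply: eA; rewrite -ball_normE.
by apply/nbhs_ballP; exists e => //= y; rewrite -ball_normE; exact: eA.
Qed.

Lemma terminal_shift x y X : terminal P T F Pi x X ->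
  terminal P T F Pi (x + y) (X + cst y).
Proof.
move=> tX.
have := terminal_lin T0 D0 ler01 ler01 tX (terminal_cst D0 y).
by rewrite !scale1r.
Qed.

Lemma sup_primal_le_value x : (sup_primal x <= u x)%E.
Proof.
apply: ge_ereal_sup => _ [X [tX LX] <-]; apply: ereal_sup_ubound.
exists (cst x + X) => //; have := terminal_shift x tX.
by rewrite add0r [X + _]addrC.
Qed.

Lemma value_le_sup_primal x e : 0 < e -> (u x <= sup_primal (x + one e)%R)%E.
Proof.
move=> e0; apply: ge_ereal_sup => _ [X tX <-].
apply: (expect_le_claims tX e0) => Y CY.
by apply: ereal_sup_ubound; exists Y.
Qed.

Lemma value_mono x y : orthant (y - x) -> (u x <= u y)%E.
Proof.
move=> yx; apply: ge_ereal_sup => _ [X tX <-].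
have mX := terminal_measurable T0 usual tX.
apply: (@le_trans _ _ (expect P (tU \o (X + cst (y - x))))).
  apply: lee_realP => a aX; apply: expect_le aX => //=; [exact: mU| |].
    apply: mU; apply: (measurable_for_D sG) => //; exact: (measurable_for_cst sG).
  apply/nearW => w; apply: extension_mono => //.
  by rewrite (_ : _ - _ = y - x)// addrAC subrr add0r.
apply: ereal_sup_ubound; exists (X + cst (y - x)) => //.
by have := terminal_shift (y - x) tX; rewrite addrC subrK.
Qed.

Lemma value_concave x y (t a b : R) : 0 < t -> t < 1 ->
  (a%:E < u x)%E -> (b%:E < u y)%E ->
  ((t * a + (1 - t) * b)%R%:E <= u (t *: x + (1 - t) *: y)%R)%E.
Proof.
move=> t0 t1 /ereal_sup_gt[_ [X tX <-] aX] /ereal_sup_gt[_ [Y tY <-] bY].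
have mX := terminal_measurable T0 usual tX.
have mY := terminal_measurable T0 usual tY.
apply: (@le_trans _ _ (expect P (tU \o (t *: X + (1 - t) *: Y)))).
  apply: (expect_concave t0 t1 _ _ _ _ _ _ _ (ltW aX) (ltW bY)) => //=;
    try exact: mU.
    apply: mU; exact: (measurable_for_lin sG).
  by apply/nearW => w; exact: extension_concave.
apply: ereal_sup_ubound; exists (t *: X + (1 - t) *: Y) => //.
by apply: terminal_lin => //; rewrite ?subr_ge0 ltW.
Qed.

(** Monotonicity is the reason: [x - (e / 2) 1] is still in the closure, and a point of the domain
    within [e / 4] of it lies below every [y] within [e / 4] of [x]. *)
Lemma interior_dom_value : (dom u)° = (closure (dom u))°.
Proof.
apply/seteqP; split => x; first by apply: interiorS; exact: subset_closure.
move=> /interior_normP[e e0 ecl]; apply/interior_normP; exists (e / 4).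
  by rewrite divr_gt0.
move=> y xy.
have /ecl : `|x - (x - one (e / 2))| < e.
  rewrite opprB addrC subrK (le_lt_trans (norm_const_mx _))//; lra.
move=> /closure_normP/(_ (e / 4) ltac:(by rewrite divr_gt0))[z uz xz].
apply: (lt_le_trans uz); apply: value_mono => i.
have := le_lt_trans (ler_row_norm _ i) xz.
have := le_lt_trans (ler_row_norm _ i) xy.
rewrite !mxE !ltr_norml => /andP[? ?] /andP[? ?]; lra.
Qed.

Lemma claims_dom x X (e : R) : claims X -> 0 < e ->
  (\forall w \ae P, orthant (x + X w - one e)) -> dom u x.
Proof.
move=> cX e0 Xe; have [c ce] := @extension_const_fin _ _ _ leD _ U_utility e e0.
apply: (@lt_le_trans _ _ c%:E); first exact: ltNyr.
apply: le_trans (sup_primal_le_value x).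
apply: (@le_trans _ _ (primal x X)).
  apply: (primal_ge (c := e)) => //; first by case: cX => _ [].
  by rewrite ce.
by apply: ereal_sup_ubound; exists X.
Qed.

(** Some terminal value attainable from [x - (e / 2) 1] has expected utility above [-oo], so it is
    nonnegative; started from [x] instead, it leaves the margin [e / 2]. Truncating it at 1 makes it
    bounded. *)
Lemma interior_claim x : (dom u)° x ->
  exists2 e, 0 < e & exists2 X, claims X &
    \forall w \ae P, orthant (x + X w - one e).
Proof.
move=> /interior_normP[e e0 eu]; exists (e / 2); first by rewrite divr_gt0.
have : dom u (x - one (e / 2)).
  apply: eu; rewrite opprB addrC subrK (le_lt_trans (norm_const_mx _))//; lra.
move=> /ereal_sup_gt[_ [X tX <-] Xoo].
have mX := terminal_measurable T0 usual tX.
have [a aX] : exists a : R, (a%:E <= expect P (fun w => tU (X w)))%E.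
  move: Xoo; rewrite /comp; case: (expect _ _) => [r| |]// _; first by exists r.
  by exists 0; rewrite leey.
have X0 := expect_extension_orthant mX aX.
pose y := x - one (e / 2).
exists (fun w => map_mx (fun r => Num.min r 1) (X w) - y).
  apply: (claims_below (X := X - cst y)).
  + have := terminal_shift (- y) tX; by rewrite subrr.
  + split.
      apply: (measurable_for_D sG); last exact: (measurable_for_cst sG).
      exact: (measurable_for_min sG).
    exists (1 + `|y|); apply: filterS X0 => w X0.
    rewrite (le_trans (ler_normB _ _))// lerD2r.
    apply/row_norm_leP => // i; rewrite !mxE ger0_norm ?ge_min ?lexx ?orbT//.
    by rewrite le_min ler01 andbT.
  + apply/nearW => w i; rewrite !mxE /=.
    have : Num.min (X w 0 i) 1 <= X w 0 i by rewrite ge_min lexx.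
    lra.
apply: filterS X0 => w X0 i; rewrite /y !mxE.
have : 0 <= Num.min (X w 0 i) 1 by rewrite le_min ler01 andbT.
lra.
Qed.

Section FiniteValue.
Context {x0 : 'rV[R]_D}.
Hypothesis x0_int : (dom u)° x0.
Hypothesis u_x0 : (u x0 < +oo)%E.

(** Beyond [x0], on the line from [x], lies a point [z] of the domain, and [x0] is a proper convex
    combination of [x] and [z]. By concavity [u x = +oo] would force [u x0 = +oo]. *)
Lemma value_lt_pinfty x : (u x < +oo)%E.
Proof.
rewrite ltey; apply/eqP => ux.
have [e e0 eu] := (interior_normP _ _).1 x0_int.
pose q := e / (2 * (`|x0 - x| + 1)).
have q0 : 0 < q by rewrite divr_gt0// mulr_gt0// ltr_wpDl.
pose z := x0 + q *: (x0 - x).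
have uz : dom u z.
  apply: eu; rewrite opprD addNKr normrN normrZ (gtr0_norm q0).
  rewrite /q mulrAC ltr_pdivrMr ?mulr_gt0 ?ltr_wpDl// ltr_pM2l//.
  by have := normr_ge0 (x0 - x); lra.
have [b bz] : exists b : R, (b%:E < u z)%E.
  move: uz; rewrite /dom /=; case: (u z) => [r| |]// _.
    by exists (r - 1); rewrite lte_fin gtrBl.
  by exists 0; rewrite ltry.
pose t := q / (1 + q).
have q1 : 0 < 1 + q by rewrite addr_gt0.
have t0 : 0 < t by rewrite divr_gt0.
have t1 : t < 1 by rewrite ltr_pdivrMr// mul1r ltrDr.
have x0E : t *: x + (1 - t) *: z = x0.
  apply/rowP => i; rewrite /z /t !mxE; field; exact: lt0r_neq0.
have : (u x0 = +oo)%E.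
  apply/eqP; rewrite eq_le leey; apply: lee_realP => v _.
  rewrite -x0E.
  have -> : v = t * ((v - (1 - t) * b) / t) + (1 - t) * b.
    by field; exact: lt0r_neq0.
  by apply: value_concave => //; rewrite ux ltry.
by move=> E; have := u_x0; rewrite E ltxx.
Qed.

(** [x] is a convex combination of [x + g 1], where claims reach any level below [u x], and
    [x - (e / 2) 1], where [X0] still has utility at least [v0]. The weight [q = k / (2 A)] of the
    second point makes it cost exactly [k / 2], and [g] is solved from the requirement that the
    combination be [x]. *)
Lemma sup_primal_value x : (dom u)° x -> sup_primal x = u x.
Proof.
move=> xint; apply/eqP; rewrite eq_le sup_primal_le_value /=.
have [e e0 [X0 cX0 X0e]] := interior_claim xint.
have [|v0 v0e] := @extension_const_fin _ _ _ leD _ U_utility (e / 2).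
  by rewrite divr_gt0.
have mX0 : measurable_for (F T) X0 by case: cX0 => _ [].
have v0X : (v0%:E <= primal (x - one (e / 2))%R X0)%E.
  apply: (primal_ge (c := e / 2)) => //; first by rewrite v0e.
  by apply: filterS X0e => w h i; have := h i; rewrite !mxE; lra.
rewrite leNgt; apply/negP => sux.
have [r [rs ru]] : exists r : R, (sup_primal x <= r%:E)%E /\ (r%:E < u x)%E.
  move: sux (value_lt_pinfty x); case: (u x) => [s| |]//;
    last by rewrite ltNge leNye.
  case: (sup_primal x) => [s'| |]//; last first.
    by move=> _ _; exists (s - 1); rewrite leNye lte_fin gtrBl.
  by move=> h _; exists s'.
have [k k0 rku] : exists2 k, 0 < k & ((r + k)%:E < u x)%E.
  move: ru; case: (u x) => [s| |]//; last by exists 1; rewrite ?ltry.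
  by rewrite lte_fin => rs'; exists ((s - r) / 2); rewrite ?lte_fin; lra.
have v0r : v0 <= r.
  rewrite -lee_fin (le_trans _ rs)// (le_trans _ (_ : primal x X0 <= _)%E)//.
    apply: (primal_ge (c := e / 2)) => //; first by rewrite v0e.
    by apply: filterS X0e => w h i; have := h i; rewrite !mxE; lra.
  by apply: ereal_sup_ubound; exists X0.
pose A := r + k - v0.
have A0 : 0 < A by rewrite /A; lra.
pose q := k / (2 * A).
have q0 : 0 < q by rewrite divr_gt0// mulr_gt0.
have q1 : q < 1 by rewrite ltr_pdivrMr ?mulr_gt0// mul1r /A; lra.
pose t := 1 - q.
have t0 : 0 < t by rewrite /t; lra.
have t1 : t < 1 by rewrite /t; lra.
pose g := q * (e / 2) / t.
have g0 : 0 < g by rewrite divr_gt0// mulr_gt0// divr_gt0.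
have /ereal_sup_gt[_ [Y cY <-] rY] := lt_le_trans rku (value_le_sup_primal x g0).
have mY : measurable_for (F T) Y by case: cY => _ [].
have := primal_concave t0 t1 mY mX0 (ltW rY) v0X.
have -> : t *: (x + one g) + (1 - t) *: (x - one (e / 2)) = x.
  apply/rowP => i; rewrite !mxE /g /t; field; exact: lt0r_neq0.
move=> h.
have : ((t * (r + k) + (1 - t) * v0)%R%:E <= r%:E)%E.
  apply: le_trans rs; apply: (le_trans h); apply: ereal_sup_ubound.
  exists (t *: Y + (1 - t) *: X0) => //.
  by apply: claims_lin => //; rewrite ?subr_ge0 ltW.
have qE (q' : R) : (1 - q') * (r + k) + (1 - (1 - q')) * v0 =
  r + k - q' * (r + k - v0) by ring.
rewrite lee_fin qE -/A.
rewrite (_ : q * A = k / 2); last by rewrite /q; field; exact: lt0r_neq0.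
lra.
Qed.

(** * Dual variables: supergradients and separating functionals *)

Definition polar_functional (L : (Omega -> 'rV[R]_D) -> R) (K : R) :=
  [/\ forall a X Y, Linf X -> Linf Y -> L (a *: X + Y) = a * L X + L Y,
      forall X c, Linf X -> 0 <= c -> (\forall w \ae P, `|X w| <= c) ->
        L X <= K * c
    & forall X, claims X -> L X <= 0].

Lemma polar_functional_dual L K : polar_functional L K ->
  dual_variables P T F Pi (functional_measure L).
Proof.
move=> [Llin Lbnd LC]; split; first exact: (functional_measure_ba sG Gm Llin Lbnd).
move=> X cX; rewrite (functional_measureE sG Llin Lbnd); first exact: LC.
by case: cX.
Qed.

Lemma conjugate_le L K x (b : R) : polar_functional L K ->
  (forall Z v, Linf Z -> (v%:E <= primal x Z)%E -> v - L Z <= b) ->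
  (conjugate P T F leD U x (functional_measure L) <= b%:E)%E.
Proof.
move=> [Llin Lbnd LC] h; apply: ge_ereal_sup => _ [Z LZ <-].
rewrite (functional_measureE sG Llin Lbnd)// leeBlDr// -EFinD.
by apply: lee_realP => v /(h _ _ LZ); rewrite lee_fin; lra.
Qed.

Lemma value_le_conjugate x m : dual_variables P T F Pi m ->
  (u x <= conjugate P T F leD U x m)%E.
Proof.
move=> [bam mC]; have [C C0 mlip] := ba_pairing_lipschitz sG Gm bam.
apply/lee_addgt0Pr => e e0.
have C1 : 0 < C + 1 by rewrite ltr_wpDl.
pose g := e / (C + 1); have g0 : 0 < g by rewrite divr_gt0.
have Cg : C * g <= e.
  by rewrite /g mulrA ler_pdivrMr// mulrDr mulr1 mulrC lerDl ltW.
apply: (le_trans (value_le_sup_primal x g0)).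
apply: ge_ereal_sup => _ [Y cY <-]; have [_ LY] := cY.
pose Y' : Omega -> 'rV[R]_D := Y + cst (one g).
have LY' : Linf Y' by apply: (LinftyD sG) => //; exact: (Linfty_cst sG).
have -> : primal (x + one g)%R Y = primal x Y'.
  by congr (expect P _); apply/funext => w; rewrite -addrA [one g + _]addrC.
have : (primal x Y' - (ba_pairing m Y')%:E <= conjugate P T F leD U x m)%E.
  by apply: ereal_sup_ubound; exists Y'.
rewrite leeBlDr// => /le_trans; apply; rewrite leeD2l// lee_fin.
have : `|ba_pairing m Y' - ba_pairing m Y| <= C * g.
  apply: mlip => //; first exact: ltW.
  apply/nearW => w; rewrite (_ : Y' w - Y w = one g);
    first exact/norm_const_mx/ltW.
  by rewrite /Y' /= addrAC subrr add0r.
by rewrite ler_norml => /andP[_]; have := mC _ cY; lra.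
Qed.

(** The pairs [(X, K * c)] do two things: they put every essentially bounded [X] in the symmetric
    domain where [L] is linear, and they bound [L]. They are asked for [c > 0] only; the case
    [c = 0] follows in the limit. *)
Lemma polar_functional_bound (B : set ((Omega -> 'rV[R]_D) * R)) (K : R) :
  0 <= K -> proper_cone B ->
  (forall X c, Linf X -> 0 < c -> (\forall w \ae P, `|X w| <= c) -> B (X, K * c)) ->
  exists L : (Omega -> 'rV[R]_D) -> R,
   [/\ forall a X Y, Linf X -> Linf Y -> L (a *: X + Y) = a * L X + L Y,
      forall X c, Linf X -> 0 <= c -> (\forall w \ae P, `|X w| <= c) ->
        L X <= K * c
    & forall X r, Linf X -> B (X, r) -> L X <= r].
Proof.
move=> K0 pB BK; have [L [Llin LB]] := cone_functional pB.
have E X : Linf X -> (exists r, B (X, r)) /\ exists r, B (- X, r).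
  have ex Y : Linf Y -> exists r, B (Y, r).
    move=> LY; have [_ [c Yc]] := LY.
    exists (K * (`|c| + 1)); apply: BK; [by []|by rewrite ltr_wpDl|].
    by apply: filterS Yc => w Yc; have := ler_norm c; lra.
  by move=> LX; split; apply: ex => //; exact: (LinftyN sG).
exists L; split.
- by move=> a X Y LX LY; apply: Llin; exact: E.
- move=> X c LX c0 Xc; apply/ler_addgt0Pr => e e0.
  have K1 : 0 < K + 1 by rewrite ltr_wpDl.
  have g0 : 0 < e / (K + 1) by rewrite divr_gt0.
  apply: (@le_trans _ _ (K * (c + e / (K + 1)))).
    apply: LB; first exact: E.
    apply: BK; [by []|by rewrite ltr_wpDl|].
    by apply: filterS Xc => w Xc; lra.
  rewrite mulrDr lerD2l mulrA ler_pdivrMr// mulrDr mulr1 mulrC lerDl.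
  exact: ltW.
- by move=> X r LX BX; apply: LB => //; exact: E.
Qed.

Lemma Linfty_linearZ (L : (Omega -> 'rV[R]_D) -> R) :
  (forall a X Y, Linf X -> Linf Y -> L (a *: X + Y) = a * L X + L Y) ->
  forall a X, Linf X -> L (a *: X) = a * L X.
Proof.
move=> Llin a X LX; have L0 : L 0 = 0.
  have := Llin 1 0 0 (Linfty_cst sG 0) (Linfty_cst sG 0).
  rewrite scaler0 addr0; lra.
rewrite -[a *: X]addr0 Llin ?L0 ?addr0//; exact: (Linfty_cst sG).
Qed.

Lemma supergradient x : (dom u)° x -> exists L K s,
  [/\ polar_functional L K, u x = s%:E
    & forall Z v, Linf Z -> (v%:E <= primal x Z)%E -> v - L Z <= s].
Proof.
move=> xint.
have [e e0 [X0 cX0 X0e]] := interior_claim xint.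
have [|v0 v0e] := @extension_const_fin _ _ _ leD _ U_utility (e / 2).
  by rewrite divr_gt0.
have mC X : claims X -> measurable_for (F T) X by case=> _ [].
have [s us] : exists s : R, u x = s%:E.
  have := interior_subset xint; rewrite /dom /=.
  by have := value_lt_pinfty x; case: (u x) => [s| |]// _ _; exists s.
have sup_s X v : claims X -> (v%:E <= primal x X)%E -> v <= s.
  move=> cX vX; rewrite -lee_fin -us -(sup_primal_value xint).
  by apply: (le_trans vX); apply: ereal_sup_ubound; exists X.
have v0X : (v0%:E <= primal x X0)%E.
  apply: (primal_ge (c := e / 2)); [exact: mC|by rewrite v0e|].
  by apply: filterS X0e => w h i; have := h i; rewrite !mxE; lra.
have v0s : v0 <= s := sup_s _ _ cX0 v0X.
(* The second components are the difference quotients of the concave map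
   [Y |-> sup_C U_x (X + Y)] from 0 in the directions [- Y], so a linear map
   below them is a supergradient at 0. *)
pose B : set ((Omega -> 'rV[R]_D) * R) := [set p | exists t X v,
  [/\ 0 < t, claims X, Linf p.1, (v%:E <= primal x (X - t *: p.1)%R)%E
    & p.2 = (s - v) / t]].
(* [K * c] is the difference quotient for [X0], [v0] and the step [e / (2 * c)]: a displacement of
   at most [e / 2] leaves [x + X0] above [(e / 2) 1], where the utility is at least [v0]. *)
pose K := (s - v0) * 2 / e.
have K0 : 0 <= K.
  by apply: divr_ge0; [rewrite mulr_ge0// subr_ge0|exact: ltW].
have mXY t X Y : claims X -> Linf Y -> measurable_for (F T) (X - t *: Y).
  move=> cX LY; have [] : Linf (X - t *: Y) => //.
  apply: (LinftyB sG); [by case: cX|exact: (LinftyZ sG)].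
have pB : proper_cone B.
  split.
  - move=> Y Y' r r' [t [X [v [t0 cX /= LY vX ->]]]].
    move=> [t' [X' [v' [t0' cX' /= LY' vX' ->]]]].
    have tt : 0 < t + t' by rewrite addr_gt0.
    (* With this weight [l * t = (1 - l) * t'], so both directions receive the same step. *)
    pose l := t' / (t + t').
    have l0 : 0 < l by rewrite divr_gt0.
    have l1 : l < 1 by rewrite ltr_pdivrMr// mul1r ltrDr.
    exists (l * t), (l *: X + (1 - l) *: X'), (l * v + (1 - l) * v'); split => /=.
    + exact: mulr_gt0.
    + by apply: claims_lin => //; rewrite ?subr_ge0 ltW.
    + exact: (LinftyD sG).
    + have := primal_concave l0 l1 (mXY _ _ _ cX LY) (mXY _ _ _ cX' LY') vX vX'.
      rewrite -[l *: x + _]scalerDl addrCA subrr addr0 scale1r.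
      rewrite (_ : l *: (_ - _) + _ =
        l *: X + (1 - l) *: X' - (l * t) *: (Y + Y'))//.
      apply/funext => w; apply/rowP => i.
      by rewrite !fctE !mxE /l; field; exact: lt0r_neq0.
    + by rewrite /l; field; rewrite !lt0r_neq0.
  - move=> c Y r c0 [t [X [v [t0 cX /= LY vX ->]]]].
    exists (t / c), X, v.
    split => /=; [exact: divr_gt0|exact: cX|exact: (LinftyZ sG)| |].
      by rewrite scalerA divfK// lt0r_neq0.
    by rewrite invf_div mulrCA.
  - move=> r [t [X [v [t0 cX /= _ vX ->]]]].
    apply: divr_ge0; last exact: ltW.
    by rewrite subr_ge0; apply: (sup_s _ _ cX); rewrite scaler0 subr0 in vX.
have BK X c : Linf X -> 0 < c -> (\forall w \ae P, `|X w| <= c) -> B (X, K * c).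
  move=> LX c0 Xc; exists (e / (2 * c)), X0, v0.
  have t0 : 0 < e / (2 * c) by rewrite divr_gt0// mulr_gt0.
  split => /=; [exact: t0|exact: cX0|exact: LX| |]; last first.
    by rewrite /K; field; rewrite !lt0r_neq0.
  apply: (primal_ge (c := e / 2)); [exact: mXY|by rewrite v0e|].
  apply: filterS2 X0e Xc => w X0w Xw i.
  have := X0w i; have := le_trans (ler_row_norm (X w) i) Xw.
  rewrite ler_norml => /andP[_ Xic]; rewrite !fctE !mxE.
  have : e / (2 * c) * X w 0 i <= e / (2 * c) * c by rewrite ler_pM2l.
  rewrite (_ : e / (2 * c) * c = e / 2); last by field; rewrite lt0r_neq0.
  lra.
have [L [Llin Lbnd LB]] := polar_functional_bound K0 pB BK.
have LBn Z v : Linf Z -> (v%:E <= primal x Z)%E -> v - L Z <= s.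
  move=> LZ vZ; have Lnz : Linf (- Z) by exact: (LinftyN sG).
  have : L (- Z) <= s - v.
    apply: LB => //; exists 1, 0, v.
    split => /=; [exact: ltr01|exact: claims0|exact: Lnz| |by rewrite divr1].
    by rewrite scale1r opprK add0r.
  rewrite -scaleN1r (Linfty_linearZ Llin)//; lra.
exists L, K, s; split => //; split => // X cX.
have LX : Linf X by case: cX.
(* Adding a multiple of the claim [X] to [X0] and then moving back by it returns to [X0], so all
   multiples of [L X] stay below [s - v0]. *)
have bnd n : n.+1%:R * L X <= s - v0.
  have LXn : Linf (n.+1%:R *: X) by exact: (LinftyZ sG).
  have : L (n.+1%:R *: X) <= s - v0.
    apply: LB => //; exists 1, (X0 + n.+1%:R *: X), v0.
    split => /=; [exact: ltr01| |exact: LXn|by rewrite scale1r addrK|].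
      by rewrite -[X0]scale1r; exact: claims_lin.
    by rewrite divr1.
  by rewrite (Linfty_linearZ Llin).
rewrite leNgt; apply/negP => LX0.
have := bnd (Num.truncn ((s - v0) / L X)).
have := truncnS_gt ((s - v0) / L X); rewrite ltr_pdivrMr//; lra.
Qed.

Lemma separating_functional x : ~ closure (dom u) x -> exists L K n,
  [/\ polar_functional L K, 0 < n & L (cst x) <= - n].
Proof.
move=> xcl.
have [n n0 un] : exists2 n, 0 < n & ~ dom u (x + one n).
  apply: contrapT => h; apply: xcl; apply/closure_normP => e e0.
  exists (x + one (e / 2)).
    apply: contrapT => nu; apply: h; exists (e / 2) => //; by rewrite divr_gt0.
  by rewrite opprD addNKr normrN (le_lt_trans (norm_const_mx _))//; lra.
pose x' := x + one n.
(* [(Y, r)] is in [B] when [Y - r 1] is a claim plus a nonnegative multiple of [x']. As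
   [x = x' - n 1], the pair [(cst x, - n)] belongs to it, and this is the strict separation. *)
pose B : set ((Omega -> 'rV[R]_D) * R) := [set p | exists X l,
  [/\ claims X, 0 <= l & p.1 = X + l *: cst x' + p.2 *: cst (one 1)]].
have pB : proper_cone B.
  split.
  - move=> Y Y' r r' [X [l [cX l0 /= ->]]] [X' [l' [cX' l0' /= ->]]].
    exists (X + X'), (l + l'); split => /=.
    + rewrite -[X]scale1r -[X']scale1r; exact: claims_lin.
    + exact: addr_ge0.
    + by rewrite !scalerDl addrACA; congr (_ + _); rewrite addrACA.
  - move=> c Y r c0 [X [l [cX l0 /= ->]]].
    exists (c *: X), (c * l); split => /=.
    + by apply: claimsZ => //; exact: ltW.
    + by rewrite mulr_ge0// ltW.
    + by rewrite !scalerDr !scalerA.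
  (* For [r < 0] the claim satisfies [X + l x' = - r 1] with a positive right side. If [l > 0],
     dividing by [l] puts [x'] in the domain of [u]; if [l = 0], the claim is a positive constant
     and a large multiple of it does the same. *)
  - move=> r [X [l [cX l0 /= E]]]; rewrite leNgt; apply/negP => r0.
    have Ew w i : X w 0 i + l * x' 0 i + r = 0.
      have /(congr1 (fun y : 'rV[R]_D => y 0 i)) : (0 : 'rV[R]_D) =
        X w + l *: x' + r *: one 1 := congr1 (fun Y : Omega -> 'rV[R]_D => Y w) E.
      by rewrite /x' !mxE mulr1 => <-.
    apply: un; move: l0; rewrite le_eqVlt => /predU1P[l0|l0].
      have k0 : 0 < (`|x'| + 1) / - r by rewrite divr_gt0 ?oppr_gt0// ltr_wpDl.
      apply: (claims_dom (X := ((`|x'| + 1) / - r) *: X) (e := 1)) => //.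
        by apply: claimsZ => //; exact: ltW.
      apply/nearW => w i; rewrite !fctE mxE -/x' !mxE.
      have -> : X w 0 i = - r by have := Ew w i; rewrite -l0 mul0r; lra.
      rewrite divfK; last by rewrite oppr_eq0 lt_eqF.
      have := ler_row_norm x' i; rewrite ler_norml => /andP[+ _].
      rewrite /x' !mxE; lra.
    apply: (claims_dom (X := l^-1 *: X) (e := - r / l)).
    + by apply: claimsZ => //; rewrite invr_ge0 ltW.
    + by rewrite divr_gt0// oppr_gt0.
    + apply/nearW => w i; rewrite !fctE -/x' mxE.
      have -> : X w = \row_j (- r - l * x' 0 j).
        by apply/rowP => j; rewrite mxE; have := Ew w j; lra.
      rewrite !mxE le_eqVlt; apply/orP; left; apply/eqP.
      by field; exact: lt0r_neq0.
have BK X c : Linf X -> 0 < c -> (\forall w \ae P, `|X w| <= c) -> B (X, 1 * c).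
  move=> LX c0 Xc; exists (X - cst (one c)), 0; split; [|exact: lexx|] => /=.
    apply: claims_nonpos.
      apply: (LinftyB sG) => //; exact: (Linfty_cst sG).
    apply: filterS Xc => w Xc i; rewrite !fctE !mxE.
    have := le_trans (ler_row_norm (X w) i) Xc.
    by rewrite ler_norml => /andP[_]; lra.
  rewrite scale0r addr0 mul1r; apply/funext => w; apply/rowP => i.
  by rewrite !fctE !mxE mulr1 subrK.
have [L [Llin Lbnd LB]] := polar_functional_bound ler01 pB BK.
have Lcst z : Linf (cst z) by exact: (Linfty_cst sG).
have LC X : claims X -> L X <= 0.
  move=> cX; apply: LB; first by case: cX.
  exists X, 0; split => /=; [exact: cX|exact: lexx|].
  by rewrite !scale0r !addr0.
exists L, 1, n; split => //.
apply: LB => //; exists 0, 1; split => /=; [exact: claims0|exact: ler01|].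
rewrite scale1r add0r; apply/funext => w; apply/rowP => i.
by rewrite !fctE !mxE mulr1 addrK.
Qed.

Lemma conjugate_unbounded x (r : R) : ~ closure (dom u) x ->
  exists2 m, dual_variables P T F Pi m &
    (conjugate P T F leD U x m <= r%:E)%E.
Proof.
move=> xcl; have [L1 [K1 [s [[lin1 bnd1 pol1] us sup1]]]] := supergradient x0_int.
have [L2 [K2 [n [[lin2 bnd2 pol2] n0 L2x]]]] := separating_functional xcl.
have Lcst z : Linf (cst z) by exact: (Linfty_cst sG).
(* Translating [Z] by [x - x0] turns the supergradient inequality at [x0] into one at [x], with [A]
   as the bound. *)
pose A := s + L1 (cst (x - x0)).
pose l := `|A - r| / n.
have l0 : 0 <= l by apply: divr_ge0 => //; exact: ltW.
pose L X := L1 X + l * L2 X.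
have pL : polar_functional L (K1 + l * K2).
  split.
  - by move=> a X Y LX LY; rewrite /L lin1// lin2//; ring.
  - move=> X c LX c0 Xc; rewrite mulrDl -mulrA lerD ?bnd1//.
    by rewrite ler_wpM2l// bnd2.
  - by move=> X cX; rewrite -[0]addr0 lerD ?pol1// mulr_ge0_le0// pol2.
exists (functional_measure L); first exact: polar_functional_dual pL.
apply: (@le_trans _ _ (A - l * n)%:E); last first.
  rewrite lee_fin /l divfK ?lt0r_neq0//; have := ler_norm (A - r); lra.
apply: (conjugate_le pL) => Z v LZ vZ.
have L1Z : v - L1 Z <= A.
  have LZ' : Linf (Z + cst (x - x0)) by exact: (LinftyD sG).
  have : v - L1 (Z + cst (x - x0)) <= s.
    apply: sup1 => //; apply: (le_trans vZ).
    rewrite le_eqVlt; apply/orP; left; apply/eqP; congr (expect P _).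
    by apply/funext => w; congr tU; apply/rowP => i; rewrite !fctE !mxE; ring.
  by rewrite -[Z]scale1r lin1// scale1r mul1r /A; lra.
(* A real lower bound on the utility forces [x + Z] to be nonnegative, so [- (x + Z)] is a claim and
   [L2 Z] is at least [- L2 (cst x)]. Each unit of [l] therefore lowers the bound by [n]. *)
have L2Z : n <= L2 Z.
  have LxZ : Linf (cst x + Z) by exact: (LinftyD sG).
  have : L2 (- (cst x + Z)) <= 0.
    apply: pol2; apply: claims_nonpos; first exact: (LinftyN sG).
    have [mxZ _] := LxZ; have := expect_extension_orthant mxZ vZ.
    by apply: filterS => w; rewrite opprK.
  rewrite -scaleN1r (Linfty_linearZ lin2)// -[cst x]scale1r lin2// mul1r; lra.
have : l * n <= l * L2 Z by rewrite ler_wpM2l.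
by rewrite /L; lra.
Qed.

End FiniteValue.

End ValueFunction.

Theorem proposition3p5
  (R : realType) (dsp : measure_display) (Omega : measurableType dsp)
  (P : probability Omega R) (T : R) (F : R -> set_system Omega)
  (d D : nat) (leD : (d <= D)%N) (Pi : R -> Omega -> 'M[R]_D)
  (U : 'rV[R]_d -> \bar R)
  (T_gt0 : 0 < T)
  (F_usual : usual_filtration P T F)
  (F_left : left_sigma_algebra F T = F T)
  (Pi_bid_ask : bid_ask_process T F Pi)
  (Pi_left : \forall w \ae P, before Pi T w = Pi T w)
  (Zs_neq0 : strictly_consistent P T F Pi !=set0)
  (d_gt0 : (0 < d)%N)
  (U_borel : measurable_for borel U)
  (U_utility : supported_on U (@orthant R d))
  (u_finite : exists x0 : 'rV[R]_D,
     (dom (value_function P T F Pi leD U))^° x0 /\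
     (value_function P T F Pi leD U x0 < +oo)%E) :
  let u := value_function P T F Pi leD U in
  let Cu := closure (dom u) in
  let sup_primal := fun x : 'rV[R]_D =>
    ereal_sup [set primal P leD U x X | X in bounded_claims P T F Pi] in
  let dual := conjugate P T F leD U in
  let inf_dual := fun x : 'rV[R]_D =>
    ereal_inf [set dual x m | m in dual_variables P T F Pi] in
  [/\ forall x : 'rV[R]_D, (sup_primal x <= u x)%E /\ (u x <= inf_dual x)%E,
      (dom u)^° = Cu^° /\
      forall x : 'rV[R]_D, (dom u)^° x ->
        [/\ sup_primal x = u x,
            u x = inf_dual x,
            exists2 m, dual_variables P T F Pi m & dual x m = inf_dual x
          & u x \is a fin_num]
    & forall x : 'rV[R]_D, ~ Cu x ->
        [/\ sup_primal x = u x, u x = inf_dual x & inf_dual x = -oo%E]].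
Proof.
move=> u Cu sup_primal dual inf_dual.
have [x0 [x0_int u_x0]] := u_finite.
have le_dual x m : dual_variables P T F Pi m -> (u x <= dual x m)%E.
  exact: value_le_conjugate.
have le_inf x : (u x <= inf_dual x)%E.
  by apply/ereal_infP => _ [m Dm <-]; exact: le_dual.
have inf_le x m : dual_variables P T F Pi m -> (inf_dual x <= dual x m)%E.
  by move=> Dm; apply: ereal_inf_lbound; exists m.
have sup_le x : (sup_primal x <= u x)%E by exact: sup_primal_le_value.
split => [x|//|x xCu].
- by split.
- split; first exact: interior_dom_value.
  move=> x xint.
  have [L [K [s [pL us Ls]]]] :=
    supergradient T_gt0 F_usual F_left d_gt0 U_borel U_utility x0_int u_x0 xint.
  have {}us : u x = s%:E := us.
  have Dm := polar_functional_dual T_gt0 F_usual pL.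
  have mu : (dual x (functional_measure L) <= u x)%E.
    by rewrite us; apply: (conjugate_le T_gt0 F_usual pL).
  have ui : u x = inf_dual x.
    by apply/eqP; rewrite eq_le le_inf/= (le_trans (inf_le _ _ Dm)).
  split => //.
  + exact: (sup_primal_value T_gt0 F_usual F_left d_gt0 U_borel U_utility x0_int).
  + exists (functional_measure L) => //; apply/eqP.
    by rewrite eq_le inf_le// andbT -ui.
  + by rewrite us.
- have ux : u x = -oo%E.
    apply/eqP; rewrite -leeNy_eq leNgt; apply/negP => ux; apply: xCu.
    exact: subset_closure.
  have ix : inf_dual x = -oo%E.
    apply/eqP; rewrite -leeNy_eq; apply: lee_realP => r rx.
    have [m Dm mr] := conjugate_unbounded T_gt0 F_usual F_left d_gt0 U_borel
      U_utility x0_int u_x0 (r - 1) xCu.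
    have := le_trans rx (le_trans (inf_le x _ Dm) mr).
    by rewrite lee_fin lerBrDl gerDr ler10.
  by split; rewrite ?ux ?ix//; apply/eqP; rewrite -leeNy_eq -ux sup_le.
Qed.
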